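(* Let $d\ge3$ and let $g_t$ be the Gaussian kernel on $\mathbb R^d$, $g_t(x)=(4\pi t)^{-d/2}e^{-|x|^2/(4t)}$. (i) If $0\le r\le d-2$, $x\in\mathbb R^d$ and $t>0$, then $$\int_{\mathbb R^d}g_t(y-x)\,|y|^{-r}\,dy\le|x|^{-r}.$$ (ii) If $0<r<d-2$, $x\in\mathbb R^d$, $t>0$, $\gamma=d-2-r$, $$q(x)=\frac{\gamma(d-2-\gamma)}{|x|^2},$$ and $\tilde g$ is the Schrödinger perturbation of $g$ by $q$, then $$\int_{\mathbb R^d}\tilde g_t(x,y)\,|y|^{-r}\,dy\le|x|^{-r}.$$
   Context: Write $g_t(x,y)=g_t(y-x)$. For $q\ge0$, the Schrödinger perturbation of $g$ by $q$ is $\tilde g=\sum_{n=0}^\infty g^{(n)}$, where $g^{(0)}_t(x,y)=g_t(x,y)$ and $$g^{(n)}_t(x,y)=\int_0^t\int_{\mathbb R^d}g_s(x,z)\,q(z)\,g^{(n-1)}_{t-s}(z,y)\,dz\,ds,\qquad n\ge1.$$ Conventions: $|0|^{-r}=\infty$ for $r>0$, and $|x|^0=1$. *)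

(* Defs.v *)
From HB Require Import structures.
From mathcomp Require Import all_boot all_order all_algebra.
From mathcomp Require Import all_classical all_reals all_analysis.

Set Implicit Arguments.
Unset Strict Implicit.
Unset Printing Implicit Defensive.

Import Order.TTheory GRing.Theory Num.Theory.
Import numFieldNormedType.Exports.

Local Open Scope classical_set_scope.
Local Open Scope ring_scope.

Section measurable_rV.
Context {d} {T : sigmaRingType d} (n : nat).

Let coord : 'I_n -> 'rV[T]_n -> T := fun i x => x ord0 i.

Let rV_set0 : g_sigma_preimage coord set0.
Proof. exact: sigma_algebra0. Qed.

Let rV_setC A : g_sigma_preimage coord A -> g_sigma_preimage coord (~` A).
Proof. exact: sigma_algebraC. Qed.

Let rV_bigcup (F : (set 'rV[T]_n)^nat) : (forall i, g_sigma_preimage coord (F i)) ->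
  g_sigma_preimage coord (\bigcup_i (F i)).
Proof. exact: sigma_algebra_bigcup. Qed.

(* The product sigma-algebra: the one generated by the n coordinates. *)
HB.instance Definition _ := @isMeasurable.Build (measure_tuple_display d)
  'rV[T]_n (g_sigma_preimage coord) rV_set0 rV_setC rV_bigcup.

End measurable_rV.

Lemma measurable_rV_coord d (T : sigmaRingType d) n (i : 'I_n) :
  measurable_fun [set: 'rV[T]_n] (fun x : 'rV[T]_n => x ord0 i).
Proof.
move=> _ Y mY; rewrite setTI; apply: sub_sigma_algebra => /=.
rewrite -bigcup_seq/=; exists i => /=; first by rewrite mem_index_enum.
by exists Y => //; rewrite setTI.
Qed.

Lemma measurable_fun_rVP d1 d2 (T1 : measurableType d1) (T2 : measurableType d2)
    n (f : T1 -> 'rV[T2]_n) :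
  measurable_fun [set: T1] f <->
  forall i, measurable_fun [set: T1] (fun x => f x ord0 i).
Proof.
split=> [mf i|mf _ A mA].
  exact: measurableT_comp (measurable_rV_coord i) mf.
rewrite setTI; pose C := [set B : set 'rV[T2]_n | measurable (f @^-1` B)].
suff: C A by [].
apply: mA; split; first split.
- by rewrite /C/= preimage_set0.
- by move=> B mB; rewrite /C/= setTD preimage_setC; exact: measurableC.
- by move=> F mF; rewrite /C/= preimage_bigcup; by apply: bigcup_measurable => i _; exact: mF.
rewrite -bigcup_seq => B /= [i _] [Y mY <-].
by rewrite /C/= setTI -[X in measurable X]setTI; exact: mf.
Qed.

Lemma sigma_finite_product_measure1 d1 d2 (T1 : measurableType d1)
    (T2 : measurableType d2) (R : realType)
    (m1 : {sigma_finite_measure set T1 -> \bar R})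
    (m2 : {sigma_finite_measure set T2 -> \bar R}) :
  sigma_finite setT (m1 \x m2)%E.
Proof.
have /sigma_finiteP[F [TF ndF Foo]] := sigma_finiteT m1.
have /sigma_finiteP[G [TG ndG Goo]] := sigma_finiteT m2.
exists (fun n => F n `*` G n).
  rewrite -setXTT TF TG predeqE => -[x y]; split.
    move=> [/= [n _ Fnx] [k _ Gky]]; exists (maxn n k) => //; split.
    - by move: x Fnx; exact/subsetPset/ndF/leq_maxl.
    - by move: y Gky; exact/subsetPset/ndG/leq_maxr.
  by move=> [n _ []/= ? ?]; split; exists n.
move=> k; have [? ?] := Foo k; have [? ?] := Goo k.
split; first exact: measurableX.
by rewrite product_measure1E// lte_mul_pinfty// ge0_fin_numE.
Qed.

Section lebesgue_measure_rV.
Context {R : realType}.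
Local Notation T := (measurableTypeR R).

Definition rV_cons n (p : T * 'rV[T]_n) : 'rV[T]_n.+1 :=
  row_mx (const_mx p.1 : 'rV_1) p.2.

Lemma rV_cons0 n (p : T * 'rV[T]_n) : rV_cons p ord0 ord0 = p.1.
Proof.
have -> : ord0 = lshift n (ord0 : 'I_1) :> 'I_(1 + n) by exact: val_inj.
by rewrite [LHS](row_mxEl (const_mx p.1 : 'rV_1)) mxE.
Qed.

Lemma rV_consS n (p : T * 'rV[T]_n) i :
  rV_cons p ord0 (lift ord0 i) = p.2 ord0 i.
Proof.
have -> : lift ord0 i = rshift 1 i :> 'I_(1 + n) by exact: val_inj.
exact: row_mxEr.
Qed.

Definition rV_uncons n (x : 'rV[T]_n.+1) : T * 'rV[T]_n :=
  (x ord0 ord0, \row_i x ord0 (lift ord0 i)).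

Lemma rV_consK n : cancel (@rV_cons n) (@rV_uncons n).
Proof.
move=> [a v]; rewrite /rV_uncons rV_cons0; congr pair.
by apply/rowP => i; rewrite mxE rV_consS.
Qed.

Lemma rV_unconsK n : cancel (@rV_uncons n) (@rV_cons n).
Proof.
move=> x; apply/rowP => i.
have [j ->|->] := unliftP ord0 i; last by rewrite rV_cons0.
by rewrite rV_consS mxE.
Qed.

Lemma measurable_rV_cons n : measurable_fun setT (@rV_cons n).
Proof.
apply/measurable_fun_rVP => i.
have [j ->|->] := unliftP ord0 i; last first.
  by under eq_fun do rewrite rV_cons0; exact: measurable_fst.
under eq_fun do rewrite rV_consS.
exact: measurableT_comp (measurable_rV_coord j) measurable_snd.
Qed.

Lemma measurable_rV_uncons n : measurable_fun setT (@rV_uncons n).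
Proof.
apply: measurable_fun_pair; first exact: measurable_rV_coord.
apply/measurable_fun_rVP => i.
by under eq_fun do rewrite mxE; exact: measurable_rV_coord.
Qed.

Section cons_measure.
Variables (n : nat) (mu : {sigma_finite_measure set 'rV[T]_n -> \bar R}).

Definition cons_measure : set 'rV[T]_n.+1 -> \bar R :=
  pushforward (lebesgue_measure \x mu)%E (@rV_cons n).

Let cons_measure0 : cons_measure set0 = 0%E.
Proof. by rewrite /cons_measure /pushforward preimage_set0 measure0. Qed.

Let cons_measure_ge0 A : (0 <= cons_measure A)%E.
Proof. by rewrite /cons_measure /pushforward measure_ge0. Qed.

Let cons_measure_sigma_additive : semi_sigma_additive cons_measure.
Proof.
move=> F mF tF mUF; rewrite /cons_measure /pushforward preimage_bigcup.
apply: measure_semi_sigma_additive.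
- by move=> i; rewrite -[X in measurable X]setTI; exact: measurable_rV_cons.
- apply/trivIsetP => i j _ _ ij; rewrite -preimage_setI.
  by move/trivIsetP : tF => /(_ _ _ _ _ ij) ->//; rewrite preimage_set0.
- by rewrite -preimage_bigcup -[X in measurable X]setTI; exact: measurable_rV_cons.
Qed.

HB.instance Definition _ := isMeasure.Build _ _ _ cons_measure
  cons_measure0 cons_measure_ge0 cons_measure_sigma_additive.

Let cons_measure_sigma_finite : sigma_finite setT cons_measure.
Proof.
have [F TF Foo] := sigma_finite_product_measure1 lebesgue_measure mu.
exists (fun k => @rV_uncons n @^-1` F k).
  by rewrite -preimage_bigcup -TF preimage_setT.
move=> k; have [mFk Fkoo] := Foo k; split.
  by rewrite -[X in measurable X]setTI; exact: measurable_rV_uncons.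
rewrite /cons_measure /pushforward -comp_preimage.
by rewrite (_ : rV_uncons (n:=n) \o _ = id)//; apply/funext => p /=; rewrite rV_consK.
Qed.

HB.instance Definition _ := Measure_isSigmaFinite.Build _ _ _ cons_measure
  cons_measure_sigma_finite.

End cons_measure.

(* Lebesgue measure on the product sigma-algebra of R^n: the unit mass on R^0,
   then the image of the product measure under R * R^n ~ R^(n+1). *)
Fixpoint lebesgue_rV (n : nat) : {sigma_finite_measure set 'rV[T]_n -> \bar R} :=
  if n is m.+1 then cons_measure (lebesgue_rV m) else @dirac _ 'rV[T]_0 0 R.

Lemma measurable_box n (A : 'I_n -> set T) : (forall i, measurable (A i)) ->
  measurable [set x : 'rV[T]_n | forall i, A i (x ord0 i)].
Proof.
move=> mA.
have -> : [set x : 'rV[T]_n | forall i, A i (x ord0 i)] =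
    \big[setI/setT]_(i < n) [set x : 'rV[T]_n | A i (x ord0 i)].
  rewrite -bigcap_seq; apply/seteqP; split => x /= Ax i; first by move=> _.
  by apply: Ax; rewrite /= mem_index_enum.
apply: bigsetI_measurable => i _; rewrite -[X in measurable X]setTI.
exact: measurable_rV_coord.
Qed.

Lemma lebesgue_rV_box n (A : 'I_n -> set T) : (forall i, measurable (A i)) ->
  lebesgue_rV n [set x | forall i, A i (x ord0 i)] =
  (\prod_(i < n) lebesgue_measure (A i))%E.
Proof.
elim: n => [|n IH] in A *; move=> mA.
  by rewrite big_ord0 /= diracE mem_set// => -[].
rewrite big_ord_recl -IH//= /cons_measure /pushforward -product_measure1E//.
  congr (_ _); apply/seteqP; split => -[a v] /=.
    move=> Aav; split=> [|i]; first by have := Aav ord0; rewrite rV_cons0.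
    by have := Aav (lift ord0 i); rewrite rV_consS.
  move=> [Aa Av] i.
  have [j ->|->] := unliftP ord0 i; last by rewrite rV_cons0.
  by rewrite rV_consS; exact: Av.
exact: (@measurable_box n (fun i => A (lift ord0 i))).
Qed.

End lebesgue_measure_rV.

Section heat_kernel.
Context {R : realType} (d : nat).
Implicit Types (x y : 'rV[R]_d) (r t : R).

(* The norm `|x| of the library on row vectors is the sup norm. *)
Definition enorm x : R := Num.sqrt (\sum_(i < d) x ord0 i ^+ 2).

(* |x|^{-r} for 0 <= r, with |0|^{-r} = +oo if 0 < r, and |x|^0 = 1
   (note that powR satisfies 0 `^ s = 0 for s != 0). *)
Definition enormVpow r x : \bar R :=
  if (x == 0) && (0 < r) then +oo%E else (enorm x `^ (- r))%:E.

(* The density (4 pi t)^(-d/2) e^(-|x|^2/(4t)); only its values at 0 < t matter. *)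
Definition gauss t x : R :=
  (4 * pi * t) `^ (- (d%:R / 2)) * expR (- (enorm x ^+ 2 / (4 * t))).

Definition gauss_kernel t x y : \bar R := (gauss t (y - x))%:E.

Definition hardy_potential (gamma : R) x : \bar R :=
  ((gamma * (d%:R - 2 - gamma))%:E * enormVpow 2 x)%E.

Section schrodinger.
Variables (g : R -> 'rV[R]_d -> 'rV[R]_d -> \bar R) (q : 'rV[R]_d -> \bar R).

(* For nonnegative g and q the iterated integrals and the series below are
   taken in [0, +oo]; the time endpoints 0 and t, where g is not meaningful,
   are left out of the domain of integration. *)
Fixpoint schrodinger_term (n : nat) t x y : \bar R :=
  if n is m.+1 then
    (\int[lebesgue_measure]_(s in `]0%R, t[)
       \int[lebesgue_rV d]_z (g s x z * q z * schrodinger_term m (t - s)%R z y))%E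
  else g t x y.

Definition schrodinger_perturbation t x y : \bar R :=
  (\sum_(0 <= n <oo) schrodinger_term n t x y)%E.

End schrodinger.
End heat_kernel.

(* Main.v *)
Require Import Defs.
From mathcomp Require Import all_boot all_order all_algebra.
From mathcomp Require Import all_classical all_reals all_analysis.
From mathcomp Require Import measurable_realfun ring lra.

(* With beta = (d - 2 - r) / 2 >= 0, the function |x|^{-r} is, up to a positive
   constant and for x != 0, the mixture h(x) = \int_0^oo s^beta g_s(x) ds.
   By the semigroup property, P_t h(x) = \int_t^oo (v - t)^beta g_v(x) dv, which
   is at most h(x) because v^beta is nondecreasing: this is (i).
   Likewise the constant in q is such that q h is at most the mixture with
   weight beta s^(beta - 1), the derivative of s^beta, so that
     P_t h + \int_0^t P_s (q h) ds <= h
   by Tonelli and the fundamental theorem of calculus. If u_n(t, x) is the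
   integral of the n-th perturbation term against h, then
     u_(n+1)(t, .) = \int_0^t P_s (q u_n(t - s, .)) ds,
   and the inequality above gives u_0 + ... + u_N <= h by induction on N. *)

Set Implicit Arguments.
Unset Strict Implicit.
Unset Printing Implicit Defensive.

Import Order.TTheory GRing.Theory Num.Theory.
Import numFieldNormedType.Exports.

Local Open Scope classical_set_scope.
Local Open Scope ring_scope.

(** * Integrals on the half-line *)

Section real_line.
Context {R : realType}.
Local Notation mu := (@lebesgue_measure R).
Local Notation T := (measurableTypeR R).

Lemma ler_powRl (r x y : R) : 0 <= r -> 0 <= x -> x <= y -> x `^ r <= y `^ r.
Proof.
move=> r0 x0 xy; apply: (ge0_ler_powR r0) => //; rewrite nnegrE//.
exact: le_trans xy.
Qed.

Lemma measurable_invr : measurable_fun [set: R] (fun x : R => x^-1).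
Proof.
have -> : (fun x : R => x^-1) =
    (fun x => if 0 < x then x `^ (-1) else - ((- x) `^ (-1))).
  apply/funext => x; case: ltP => x0; first by rewrite powR_inv1// ltW.
  by rewrite powR_inv1 ?oppr_ge0// invrN opprK.
have mp := @measurable_powR R (-1).
apply: measurable_fun_ifT => //; first exact: measurable_fun_ltr.
apply: measurableT_comp => //.
by apply: (measurableT_comp mp).
Qed.

Lemma ge0_integral_affine (a b : R) (D : set R) (f : R -> \bar R) : 0 < a ->
  measurable D -> measurable_fun setT f -> (forall x, (0 <= f x)%E) ->
  (\int[mu]_(x in D) f x =
   a%:E * \int[mu]_(x in (fun s => a * s + b)%R @^-1` D) f (a * x + b)%R)%E.
Proof.
move=> a0 mD mf f0.
pose phi : T -> T := fun s => a * s + b.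
have mphi : measurable_fun setT phi.
  by apply: measurable_funD => //; apply: measurable_funM.
pose m : {measure set T -> \bar R} :=
  measure_function_pushforward__canonical__measure_function_Measure mu mphi.
have muE A : measurable A ->
    mu A = mscale (NngNum (ltW a0)) m A.
  move=> mA; apply: lebesgue_measure_unique => //= _ [[u v] /= uv] <-.
  rewrite /mscale /= /pushforward.
  have -> : phi @^-1` `]u, v] = `](u - b) / a, (v - b) / a]%classic.
    apply/seteqP; split=> s /=; rewrite !in_itv/= /phi.
      by rewrite ltr_pdivrMr// ler_pdivlMr// ltrBlDr lerBrDr mulrC.
    by rewrite ltr_pdivrMr// ler_pdivlMr// ltrBlDr lerBrDr mulrC.
  rewrite !lebesgue_measure_itv/= !lte_fin ltr_pM2r ?invr_gt0// ltrD2r.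
  case: ifPn => _; last by rewrite mule0.
  by rewrite -!EFinB -EFinM; congr EFin; field; rewrite gt_eqF.
rewrite (eq_measure_integral (mscale (NngNum (ltW a0)) m)); last first.
  by move=> A mA _; exact: muE.
rewrite ge0_integral_mscale//; last exact: measurable_funS mf.
by rewrite ge0_integral_pushforward//; apply: measurable_funS mf.
Qed.

Lemma ge0_integral_shift (t : R) (f : R -> \bar R) :
  measurable_fun setT f -> (forall x, (0 <= f x)%E) ->
  (\int[mu]_(x in `]t, +oo[) f x = \int[mu]_(x in `]0%R, +oo[) f (x + t)%R)%E.
Proof.
move=> mf f0; rewrite (@ge0_integral_affine 1 t)// mul1e.
rewrite (_ : _ @^-1` _ = `]0, +oo[%classic).
  by apply: eq_integral => x _; rewrite mul1r.
by apply/seteqP; split=> s /=; rewrite !in_itv/= !andbT mul1r ltrDr.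
Qed.

Lemma ge0_integral_scale (a : R) (f : R -> \bar R) : 0 < a ->
  measurable_fun setT f -> (forall x, (0 <= f x)%E) ->
  (\int[mu]_(x in `]0%R, +oo[) f x =
   a%:E * \int[mu]_(x in `]0%R, +oo[) f (a * x)%R)%E.
Proof.
move=> a0 mf f0; rewrite (@ge0_integral_affine a 0)//; congr (_ * _)%E.
rewrite (_ : _ @^-1` _ = `]0, +oo[%classic).
  by apply: eq_integral => x _; rewrite addr0.
by apply/seteqP; split=> s /=; rewrite !in_itv/= !andbT addr0 pmulr_rgt0.
Qed.

Lemma integral_derive (F f : R -> R) (a b : R) : a < b ->
  {in `[a, b], forall x : R, is_derive x 1 F (f x)} ->
  {in `[a, b], forall x : R, derivable f x 1} ->
  (\int[mu]_(x in `[a, b]) (f x)%:E = (F b - F a)%:E)%E.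
Proof.
move=> ab dF df; rewrite EFinB.
have cF x : x \in `[a, b] -> {for x, continuous F}.
  by move=> /dF [+ _]; move/derivable1_diffP/differentiable_continuous.
apply: continuous_FTC2 => //.
- exact: derivable_within_continuous.
- split.
  + by move=> x xab; have [] := dF x (subset_itv_oo_cc xab).
  + by apply: cvg_at_right_filter; apply: cF; rewrite in_itv/= lexx ltW.
  + by apply: cvg_at_left_filter; apply: cF; rewrite in_itv/= lexx ltW.
- move=> x xab; have [_ <-] := dF x (subset_itv_oo_cc xab).
  by rewrite derive1E.
Qed.

Lemma ge0_integral_derivey (F f : R -> R) (a l : R) :
  {in `[a, +oo[, forall x, 0 <= f x} ->
  {in `[a, +oo[, forall x : R, is_derive x 1 F (f x)} ->
  {in `[a, +oo[, forall x : R, derivable f x 1} ->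
  F x @[x --> +oo%R] --> l ->
  (\int[mu]_(x in `[a, +oo[) (f x)%:E = (l - F a)%:E)%E.
Proof.
move=> f0 dF df Fl; rewrite EFinB.
have H x : a < x -> x \in `[a, +oo[ by move=> ax; rewrite in_itv/= ltW.
apply: ge0_continuous_FTC2y => //.
- by move=> x ax; apply: f0; rewrite in_itv/= ax.
- exact: derivable_within_continuous.
- by move=> x /H /dF [].
- apply: cvg_at_right_filter.
  have /dF[+ _] : a \in `[a, +oo[ by rewrite in_itv/= lexx.
  by move/derivable1_diffP/differentiable_continuous.
- move=> x; rewrite in_itv/= andbT => /H /dF [_ <-].
  by rewrite derive1E.
Qed.

End real_line.

Section fubini_tonelli_dom.
Local Open Scope ereal_scope.
Context d1 d2 (T1 : measurableType d1) (T2 : measurableType d2) (R : realType).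
Variables (m1 : {sigma_finite_measure set T1 -> \bar R})
  (m2 : {sigma_finite_measure set T2 -> \bar R}).

Lemma fubini_tonelli_dom (A1 : set T1) (B1 : T1 -> set T2)
    (B2 : set T2) (A2 : T2 -> set T1) (f : T1 * T2 -> \bar R) :
  measurable [set p : T1 * T2 | A1 p.1 /\ B1 p.1 p.2] ->
  (forall x y, A1 x /\ B1 x y <-> B2 y /\ A2 y x) ->
  measurable_fun setT f -> (forall p, 0 <= f p) ->
  \int[m1]_(x in A1) \int[m2]_(y in B1 x) f (x, y) =
  \int[m2]_(y in B2) \int[m1]_(x in A2 y) f (x, y).
Proof.
set E := [set p | _] => mE AB mf f0.
have mfE : measurable_fun setT (f \_ E).
  exact/(measurable_restrictT f mE)/measurable_funTS.
have fE0 p : 0 <= (f \_ E) p by apply: erestrict_ge0 => q _.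
have := @fubini_tonelli _ _ _ _ _ m1 m2 _ mfE fE0.
rewrite (_ : \int[m1]_x _ = \int[m1]_(x in A1) \int[m2]_(y in B1 x) f (x, y)).
  move=> ->; rewrite [RHS]integral_mkcond; apply: eq_integral => y _.
  rewrite [RHS]patchE; case: ifPn => [/set_mem B2y|/negP B2y].
    rewrite [RHS]integral_mkcond; apply: eq_integral => x _.
    rewrite !patchE; congr (if _ then _ else _).
    apply/idP/idP => /set_mem H; apply/mem_set.
      by have [_] := (AB x y).1 H.
    by apply/(AB x y).2.
  apply: integral0_eq => x _; rewrite patchE ifF//; apply/negP => /set_mem.
  by move=> /AB[H _]; apply: B2y; apply/mem_set.
rewrite [RHS]integral_mkcond; apply: eq_integral => x _.
rewrite [RHS]patchE; case: ifPn => [/set_mem A1x|/negP A1x].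
  rewrite [RHS]integral_mkcond; apply: eq_integral => y _.
  rewrite !patchE; congr (if _ then _ else _).
  by apply/idP/idP => /set_mem H; apply/mem_set; [case: H|split].
apply: integral0_eq => y _; rewrite patchE ifF//; apply/negP => /set_mem.
by move=> [H _]; apply: A1x; apply/mem_set.
Qed.

Lemma measurable_fun_integral_dom (B : T1 -> set T2) (f : T1 * T2 -> \bar R) :
  measurable [set p : T1 * T2 | B p.1 p.2] ->
  measurable_fun setT f -> (forall p, 0 <= f p) ->
  measurable_fun setT (fun x => \int[m2]_(y in B x) f (x, y)).
Proof.
set E := [set p | _] => mE mf f0.
have mfE : measurable_fun setT (f \_ E).
  exact/(measurable_restrictT f mE)/measurable_funTS.
have fE0 p : 0 <= (f \_ E) p by apply: erestrict_ge0 => q _.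
have := @measurable_fun_fubini_tonelli_F _ _ _ _ _ m2 _ mfE fE0.
congr (measurable_fun _ _); apply/funext => x.
rewrite /fubini_F [RHS]integral_mkcond; apply: eq_integral => y _.
by rewrite !patchE; congr (if _ then _ else _).
Qed.

End fubini_tonelli_dom.

Section time_integrals.
Context {R : realType}.
Local Notation mu := (@lebesgue_measure R).
Local Notation T := (measurableTypeR R).

Lemma measurable_lt_set d (X : measurableType d) (f g : X -> R) :
  measurable_fun setT f -> measurable_fun setT g ->
  measurable [set x | f x < g x].
Proof.
move=> mf mg; rewrite -[X in measurable X]setTI.
have := @measurable_lte _ _ R _ measurableT (EFin \o f) (EFin \o g).
by apply; exact: measurableT_comp.
Qed.

Lemma ge0_integral_oo_le (a b : R) (f : R -> \bar R) (M : \bar R) :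
  measurable_fun setT f -> (forall x, 0 <= f x)%E ->
  (forall u v, a < u -> u < v -> v < b ->
    (\int[mu]_(x in `[u, v]) f x <= M)%E) -> (0 <= M)%E ->
  (\int[mu]_(x in `]a, b[) f x <= M)%E.
Proof.
move=> mf f0 H M0.
have [ba|ab] := leP b a.
  by rewrite set_itv_ge ?integral_set0// bnd_simp -leNgt.
pose F n : set T := `[a + (b - a) / n.+3%:R, b - (b - a) / n.+3%:R]%classic.
have F0 n : 0 < (b - a) / n.+3%:R by rewrite divr_gt0 ?subr_gt0.
have FE : `]a, b[%classic = \bigcup_n F n.
  apply/seteqP; split => [x /=|x [n _]]; rewrite /F/= !in_itv/=.
    move=> /andP[ax xb].
    pose e := Num.min (x - a) (b - x).
    have e0 : 0 < e by rewrite lt_min !subr_gt0 ax xb.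
    have q0 : 0 <= (b - a) / e by rewrite ltW// divr_gt0 ?subr_gt0.
    exists (Num.bound ((b - a) / e)) => //; rewrite /F /= in_itv/=.
    have : (b - a) / (Num.bound ((b - a) / e)).+3%:R <= e.
      rewrite ler_pdivrMr// mulrC -ler_pdivrMr//.
      by rewrite (le_trans (ltW (archi_boundP q0)))// ler_nat -addn3 leq_addr.
    move: (_ / _.+3%:R) => q.
    by rewrite le_min => /andP[? ?]; apply/andP; split; lra.
  have := F0 n; move: (_ / _.+3%:R) => q.
  by move=> ? /andP[? ?]; apply/andP; split; lra.
rewrite FE.
have cF : (\int[mu]_(x in F n) f x)%E @[n --> \oo] --> (\int[mu]_(x in \bigcup_n F n) f x)%E.
  apply: ge0_nondecreasing_set_cvg_integral => //.
  - apply/nondecreasing_seqP => n; apply/subsetPset => x /=.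
    rewrite /F/= !in_itv/= => /andP[h1 h2].
    have h : (b - a) / n.+4%:R <= (b - a) / n.+3%:R.
      by rewrite ler_pM2l ?subr_gt0// lef_pV2 ?posrE// ler_nat.
    move: (_ / n.+4%:R) (_ / n.+3%:R) h h1 h2 => q q' ? ? ?.
    by apply/andP; split; lra.
  - by move=> n; exact: measurable_itv.
  - by move=> n; exact: (measurable_funS measurableT (@subsetT _ _) mf).
rewrite -(cvg_lim _ cF)//; apply: lime_le; first by apply/cvg_ex; eexists; exact: cF.
apply: nearW => n.
have h : (b - a) / n.+3%:R < (b - a) / 2.
  by rewrite ltr_pM2l ?subr_gt0// ltf_pV2 ?posrE// ltr_nat.
move: (F0 n) h; rewrite /F; move: (_ / n.+3%:R) => q q0 h.
by apply: H; lra.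
Qed.


Lemma is_derive_powR_shift (v b s : R) : s < v ->
  is_derive s 1 (fun s => - ((v - s) `^ b)) (b * (v - s) `^ (b - 1)).
Proof.
move=> sv; have d1 : is_derive s 1 (fun s => v - s) (-1).
  by apply: is_derive_eq; rewrite add0r mul1r.
have d2 : is_derive (v - s) 1 (@powR R ^~ b) (b * (v - s) `^ (b - 1)).
  by apply: is_derive1_powR; rewrite subr_gt0.
have d3 := @is_derive1_comp R (@powR R ^~ b) (fun s => v - s) s _ _ d2 d1.
by have := is_deriveN d3; rewrite mulrN1 opprK.
Qed.

Lemma measurable_powR_shift (v b : R) :
  measurable_fun setT (fun s : R => (v - s) `^ b).
Proof.
by apply: (measurableT_comp (measurable_powR b)); apply: measurable_funB.
Qed.

Lemma integral_powR_shift_le (b v c : R) : 0 < b -> 0 < c -> c <= v ->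
  (\int[mu]_(s in `]0%R, c[) (b * (v - s) `^ (b - 1))%:E <=
   (v `^ b - (v - c) `^ b)%:E)%E.
Proof.
move=> b0 c0 cv; apply: ge0_integral_oo_le.
- apply/measurable_EFinP; apply: measurable_funM => //.
  exact: measurable_powR_shift.
- by move=> s; rewrite lee_fin mulr_ge0 ?powR_ge0// ltW.
- move=> u w u0 uw wc.
  rewrite (@integral_derive _ (fun s => - ((v - s) `^ b)))//.
  + rewrite lee_fin opprK addrC lerB//.
      by rewrite ge0_ler_powR ?nnegrE ?subr_ge0//; lra.
    by rewrite ge0_ler_powR ?nnegrE ?subr_ge0//; lra.
  + move=> s; rewrite in_itv/= => /andP[us sw].
    by apply: is_derive_powR_shift; lra.
  + move=> s; rewrite in_itv/= => /andP[us sw].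
    apply: derivableM => //.
    have sv : s < v by lra.
    have [+ _] := @is_derive_powR_shift v (b - 1) s sv.
    by move=> /derivableN; rewrite (_ : - _ = fun s => (v - s) `^ (b - 1))//;
      apply/funext => z; rewrite fctE opprK.
- by rewrite lee_fin subr_ge0 ge0_ler_powR ?nnegrE//; lra.
Qed.

Lemma integral_powR_tail (b v : R) : 0 < b -> 0 < v ->
  (\int[mu]_(s in `]v, +oo[) (b * s `^ (- b - 1))%:E = (v `^ (- b))%:E)%E.
Proof.
move=> b0 v0.
have mp : measurable_fun setT (fun s : R => b * s `^ (- b - 1)).
  by apply: measurable_funM => //; exact: measurable_powR.
rewrite integral_itv_obnd_cbnd; last exact/measurable_EFinP/measurable_funTS.
rewrite (@ge0_integral_derivey _ (fun s => - (s `^ (- b))) _ v 0).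
- by rewrite sub0r opprK.
- by move=> s _; rewrite mulr_ge0 ?powR_ge0// ltW.
- move=> s; rewrite in_itv/= andbT => vs.
  have s0 : 0 < s by exact: lt_le_trans vs.
  have := is_deriveN (is_derive1_powR (- b) s0).
  by rewrite mulNr opprK.
- move=> s; rewrite in_itv/= andbT => vs.
  have s0 : 0 < s by exact: lt_le_trans vs.
  by apply: derivableM => //; apply: derivable_powR; rewrite in_itv/= andbT.
- rewrite -oppr0; apply: cvgN.
  rewrite (_ : (fun x => _) = (fun x => (x `^ b)^-1)); last first.
    by apply/funext => s; rewrite powRN.
  apply/(@gtr0_cvgV0 _ _ _ _ (@powR R ^~ b)).
    by near=> s; apply: powR_gt0; near: s; exact: nbhs_pinfty_gt.
  apply/cvgryPge => A; near=> s.
  have M0 : 0 < Num.max A 1 by rewrite lt_max ltr01 orbT.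
  apply: (@le_trans _ _ (Num.max A 1)); first by rewrite le_max lexx.
  rewrite -[leLHS](powRr1 (ltW M0)) -(mulVf (lt0r_neq0 b0)) powRrM.
  rewrite ge0_ler_powR ?nnegrE ?powR_ge0 ?(ltW b0)//.
Unshelve. all: by end_near. Qed.

Lemma expR_inv_le (y : R) : 0 < y -> expR (- y) <= y^-1.
Proof.
move=> y0; rewrite expRN lef_pV2 ?posrE ?expR_gt0//.
by rewrite (le_trans _ (expR_ge1Dx y))// lerDr.
Qed.

Lemma is_derive_expRV (s : R) : 0 < s ->
  is_derive s 1 (fun s => expR (- (4 * s)^-1))
    ((4 * s ^+ 2)^-1 * expR (- (4 * s)^-1)).
Proof.
move=> s0; have d1 : is_derive s 1 (fun s : R => 4 * s) 4.
  by apply: is_derive_eq; rewrite [_ *: _]mulr1.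
have d2 : is_derive s 1 (fun s : R => - (4 * s)^-1) (4 * s ^+ 2)^-1.
  have s4 : 4 * s != 0 by rewrite gt_eqF// mulr_gt0.
  have := is_deriveN (@is_deriveV R (fun s => 4 * s) s 4 1 s4 d1).
  by congr is_derive; rewrite [_ *: _]mulNr opprK; field; lra.
rewrite mulrC.
exact: (@is_derive1_comp R expR (fun s => - (4 * s)^-1) s _ _
  (is_derive_expR _) d2).
Qed.

Definition expRV_derive (s : R) : R := (4 * s ^+ 2)^-1 * expR (- (4 * s)^-1).

Lemma expRV_derive_ge0 s : 0 <= expRV_derive s.
Proof. by rewrite mulr_ge0 ?expR_ge0// invr_ge0 mulr_ge0// sqr_ge0. Qed.

Lemma measurable_expRV : measurable_fun setT (fun s : R => expR (- (4 * s)^-1)).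
Proof.
apply: measurableT_comp => //; apply: measurableT_comp => //.
apply: (measurableT_comp (@measurable_invr R)).
exact: measurable_funM.
Qed.

Lemma measurable_expRV_derive : measurable_fun setT expRV_derive.
Proof.
apply: measurable_funM; last exact: measurable_expRV.
apply: (measurableT_comp (@measurable_invr R)).
by apply: measurable_funM => //; exact: measurable_funX.
Qed.

Lemma expRV_le_integral (s : R) : 0 < s ->
  ((expR (- (4 * s)^-1))%:E <= \int[mu]_(v in `]0%R, s[) (expRV_derive v)%:E)%E.
Proof.
move=> s0; apply/lee_addgt0Pr => e e0.
pose d := Num.min (e / 4) (s / 2).
have d0 : 0 < d by rewrite lt_min !divr_gt0.
have de : d <= e / 4 by rewrite ge_min lexx.
have ds : d < s by rewrite gt_min; apply/orP; right; lra.
have mE D : measurable D -> measurable_fun D (fun v => (expRV_derive v)%:E).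
  by move=> mD; apply/measurable_EFinP/measurable_funTS; exact: measurable_expRV_derive.
have : (\int[mu]_(v in `[d, s]) (expRV_derive v)%:E =
    (expR (- (4 * s)^-1) - expR (- (4 * d)^-1))%:E)%E.
  rewrite (@integral_derive _ (fun s => expR (- (4 * s)^-1)))//.
    move=> v; rewrite in_itv/= => /andP[dv _].
    by apply: is_derive_expRV; exact: lt_le_trans dv.
  move=> v; rewrite in_itv/= => /andP[dv _].
  have v0 : 0 < v by exact: lt_le_trans dv.
  apply: derivableM; last by have [] := is_derive_expRV v0.
  apply: derivableV; first by rewrite gt_eqF// mulr_gt0// exprn_gt0.
  by apply: derivableM => //; exact: derivableX.
rewrite integral_itv_bndoo; last exact: mE.
move=> E; apply: (@le_trans _ _ ((\int[mu]_(v in `]d, s[) (expRV_derive v)%:E)%E + e%:E)%E).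
  rewrite E -EFinD lee_fin -lerBlDl opprB addrC subrK.
  rewrite (le_trans (expR_inv_le _)) ?invr_gt0 ?mulr_gt0// invrK; lra.
rewrite leeD2r//; apply: ge0_subset_integral => //; first exact: mE.
  by move=> v _; rewrite lee_fin expRV_derive_ge0.
by apply: subset_itvr; rewrite bnd_simp ltW.
Qed.

(* [gamma_integral b] is 4^b Gamma(b). *)
Definition gamma_integral (b : R) : \bar R :=
  \int[mu]_(s in `]0%R, +oo[) (s `^ (- b - 1) * expR (- (4 * s)^-1))%:E.

Lemma measurable_gamma_integral (b : R) :
  measurable_fun setT (fun s : R => s `^ (- b - 1) * expR (- (4 * s)^-1)).
Proof. by apply: measurable_funM; [exact: measurable_powR|exact: measurable_expRV]. Qed.

Lemma gamma_integral_integrand_ge0 (b s : R) : 0 <= s `^ (- b - 1) * expR (- (4 * s)^-1).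
Proof. by rewrite mulr_ge0 ?powR_ge0 ?expR_ge0. Qed.

Lemma gamma_integral_scale (b rho : R) : 0 < rho ->
  (\int[mu]_(s in `]0%R, +oo[)
     (s `^ (- b - 1) * expR (- (rho / (4 * s))))%:E =
   (rho `^ (- b))%:E * gamma_integral b)%E.
Proof.
move=> rho0; rewrite (@ge0_integral_scale _ rho) //; last 2 first.
- apply/measurable_EFinP; apply: measurable_funM; first exact: measurable_powR.
  apply: measurableT_comp => //; apply: measurableT_comp => //.
  apply: measurable_funM => //.
  by apply: (measurableT_comp (@measurable_invr R)); exact: measurable_funM.
- by move=> s; rewrite lee_fin mulr_ge0 ?powR_ge0 ?expR_ge0.
have -> : rho `^ (- b) = rho * rho `^ (- b - 1).
  rewrite -[X in X * _]powRr1 ?ltW// -powRD; last first.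
    by rewrite (gt_eqF rho0) implybT.
  by congr powR; ring.
rewrite EFinM -muleA; congr (_ * _)%E.
rewrite -ge0_integralZl ?lee_fin ?powR_ge0//; last 2 first.
- by apply/measurable_EFinP/measurable_funTS; exact: measurable_gamma_integral.
- by move=> s _; rewrite lee_fin gamma_integral_integrand_ge0.
apply: eq_integral => s; rewrite inE/= in_itv/= andbT => s0.
rewrite -EFinM [in RHS]mulrA powRM ?ltW//; congr (_ * expR (- _))%:E.
by field; lra.
Qed.

Lemma gamma_integral_gt0 (b : R) : (0 < gamma_integral b)%E.
Proof.
pose c := Num.min (2 `^ (- b - 1)) 1 * expR (- 4^-1).
have c0 : 0 < c by rewrite mulr_gt0 ?expR_gt0// lt_min powR_gt0// ltr01.
apply: (@lt_le_trans _ _ (\int[mu]_(s in `[1%R, 2%R]) (cst c%:E s))%E).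
  rewrite integral_cst//= lebesgue_measure_itv/= lte_fin ifT; last by lra.
  by rewrite -EFinB -EFinM lte_fin mulr_gt0//; lra.
apply: (@le_trans _ _ (\int[mu]_(s in `[1%R, 2%R])
    (s `^ (- b - 1) * expR (- (4 * s)^-1))%:E)%E).
  apply: ge0_le_integral => //.
  - by move=> s _; rewrite lee_fin ltW.
  - by apply/measurable_EFinP/measurable_funTS; exact: measurable_gamma_integral.
  move=> s; rewrite /= in_itv/= => /andP[s1 s2]; rewrite lee_fin /c.
  have s0 : 0 < s by lra.
  rewrite ler_pM ?expR_ge0//.
  - have [b0|b0] := leP 0 (- b - 1).
      rewrite ge_min; apply/orP; right.
      apply: (@le_trans _ _ (1 `^ (- b - 1))); first by rewrite powR1.
      by rewrite ge0_ler_powR ?nnegrE ?ler01// ltW.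
    rewrite ge_min; apply/orP; left.
    rewrite -[in leLHS](opprK (- b - 1)) -[in leRHS](opprK (- b - 1)) 2!(powRN _ (- (- b - 1))).
    rewrite lef_pV2 ?posrE ?powR_gt0//.
    by rewrite ge0_ler_powR ?nnegrE //; lra.
  - by rewrite ler_expR lerN2 lef_pV2 ?posrE; lra.
apply: ge0_subset_integral => //.
- by apply/measurable_EFinP/measurable_funTS; exact: measurable_gamma_integral.
- by move=> s _; rewrite lee_fin gamma_integral_integrand_ge0.
- by move=> s /=; rewrite !in_itv/= => /andP[s1 _]; rewrite andbT; lra.
Qed.

Lemma gamma_integral_integrand_ub (b s : R) : 0 < b -> 0 < s ->
  s `^ (- b - 1) * expR (- (4 * s)^-1) <= (4 * (b + 1)) `^ (b + 1).
Proof.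
move=> b0 s0; have b1 : 0 < b + 1 by lra.
have -> : expR (- (4 * s)^-1) = expR (- (4 * (b + 1) * s)^-1) `^ (b + 1).
  by rewrite -expRM; congr expR; field; rewrite !gt_eqF.
have -> : s `^ (- b - 1) = s^-1 `^ (b + 1).
  by rewrite -powR_inv1 ?ltW// -powRrM; congr powR; ring.
rewrite -powRM ?invr_ge0 ?expR_ge0 ?(ltW s0)//.
apply: ler_powRl; rewrite ?mulr_ge0 ?invr_ge0 ?expR_ge0//; try lra.
rewrite mulrC ler_pdivrMr//.
apply: le_trans (expR_inv_le _) _; first by rewrite invr_gt0 !mulr_gt0.
by rewrite invrK.
Qed.

Lemma gamma_integral_lty (b : R) : 0 < b -> (gamma_integral b < +oo)%E.
Proof.
move=> b0; rewrite /gamma_integral.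
have m1 D : measurable D -> measurable_fun D
    (fun s : R => (s `^ (- b - 1) * expR (- (4 * s)^-1))%:E).
  by move=> mD; apply/measurable_EFinP/measurable_funTS; exact: measurable_gamma_integral.
have -> : `]0, +oo[%classic = `]0, 1] `|` `]1, +oo[ :> set R.
  by rewrite -itv_bndbnd_setU// bnd_simp.
rewrite ge0_integral_setU//=; last 3 first.
- by apply: m1; apply: measurableU.
- by move=> s _; rewrite lee_fin gamma_integral_integrand_ge0.
- rewrite disj_set2E; apply/eqP/seteqP; split => // s /=.
  by rewrite !in_itv/= andbT => -[/andP[_ s1]]; rewrite ltNge s1.
apply: lte_add_pinfty.
- apply: (@le_lt_trans _ _ (\int[mu]_(s in `]0%R, 1%R])
    (cst ((4 * (b + 1)) `^ (b + 1))%:E s))%E).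
    apply: ge0_le_integral => //; first by move=> s _; rewrite lee_fin gamma_integral_integrand_ge0.
      exact: m1.
    by move=> s; rewrite /= in_itv/= => /andP[s0 _]; rewrite lee_fin gamma_integral_integrand_ub.
  rewrite integral_cst//= lebesgue_measure_itv/= lte_fin ltr01.
  by rewrite -EFinB -EFinM ltry.
- apply: (@le_lt_trans _ _ (\int[mu]_(s in `]1%R, +oo[)
    ((b^-1)%:E * (b * s `^ (- b - 1))%:E))%E).
    apply: ge0_le_integral => //.
    + by move=> s _; rewrite lee_fin gamma_integral_integrand_ge0.
    + exact: m1.
    + apply/measurable_EFinP/measurable_funTS.
      by do 2 apply: measurable_funM => //; exact: measurable_powR.
    + move=> s; rewrite /= in_itv/= andbT => s1.
      rewrite -EFinM lee_fin mulKf ?gt_eqF// ler_piMr ?powR_ge0//.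
      have s0 : 0 <= s by lra.
      by rewrite -expR0 ler_expR oppr_le0 invr_ge0 mulr_ge0.
  rewrite ge0_integralZl//; last 3 first.
  + apply/measurable_EFinP/measurable_funTS.
    by apply: measurable_funM => //; exact: measurable_powR.
  + by move=> s _; rewrite lee_fin mulr_ge0 ?powR_ge0 ?ltW.
  + by rewrite lee_fin invr_ge0 ltW.
  by rewrite integral_powR_tail// -EFinM ltry.
Qed.

(* Half of the functional equation b Gamma(b) = Gamma(b + 1). *)
Lemma gamma_integral_succ (b : R) : 0 < b ->
  ((4 * b)%:E * gamma_integral b <= gamma_integral (b + 1))%E.
Proof.
move=> b0.
pose F (s v : R) : R := b * s `^ (- b - 1) * expRV_derive v.
have mF : measurable_fun setT (fun p : T * T => (F p.1 p.2)%:E).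
  apply/measurable_EFinP; apply: measurable_funM.
    apply: measurable_funM => //.
    exact: (measurableT_comp (measurable_powR _) measurable_fst).
  exact: (measurableT_comp measurable_expRV_derive measurable_snd).
have F0 s v : 0 <= F s v.
  by rewrite mulr_ge0 ?expRV_derive_ge0// mulr_ge0 ?powR_ge0// ltW.
have -> : ((4 * b)%:E * gamma_integral b = 4%:E * (b%:E * gamma_integral b))%E.
  by rewrite EFinM muleA.
have H1 : (b%:E * gamma_integral b <= \int[mu]_(s in `]0%R, +oo[)
    \int[mu]_(v in `]0%R, s[) (F s v)%:E)%E.
  rewrite -ge0_integralZl//; last 3 first.
  - by apply/measurable_EFinP/measurable_funTS; exact: measurable_gamma_integral.
  - by move=> s _; rewrite lee_fin gamma_integral_integrand_ge0.
  - by rewrite lee_fin ltW.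
  apply: ge0_le_integral => //.
  - by move=> s _; rewrite -EFinM lee_fin mulr_ge0 ?gamma_integral_integrand_ge0// ltW.
  - apply/measurable_EFinP/measurable_funTS; apply: measurable_funM => //.
    exact: measurable_gamma_integral.
  - apply: measurable_funTS.
    apply: (@measurable_fun_integral_dom _ _ T T R mu (fun s => `]0%R, s[%classic) _ _ mF).
      rewrite (_ : [set p | _] = [set p : T * T | 0 < p.2] `&` [set p | p.2 < p.1]).
        by apply: measurableI; apply: measurable_lt_set => //.
      by apply/seteqP; split => p /=; rewrite in_itv/= => /andP.
    by move=> p; rewrite lee_fin.
  move=> s; rewrite /= in_itv/= andbT => s0; rewrite /F.
  under eq_integral do rewrite EFinM.
  rewrite ge0_integralZl//; last 3 first.
  - by apply/measurable_EFinP/measurable_funTS; exact: measurable_expRV_derive.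
  - by move=> v _; rewrite lee_fin expRV_derive_ge0.
  - by rewrite lee_fin mulr_ge0 ?powR_ge0// ltW.
  rewrite -EFinM mulrA EFinM lee_wpmul2l//.
    by rewrite lee_fin mulr_ge0 ?powR_ge0// ltW.
  exact: expRV_le_integral.
apply: (@le_trans _ _ (4%:E * \int[mu]_(s in `]0%R, +oo[)
    \int[mu]_(v in `]0%R, s[) (F s v)%:E)%E); first by rewrite lee_wpmul2l.
rewrite (@fubini_tonelli_dom _ _ T T R mu mu `]0%R, +oo[%classic
  (fun s => `]0%R, s[%classic) `]0%R, +oo[%classic (fun v => `]v, +oo[%classic)
  _ _ _ mF); last 3 first.
- rewrite (_ : [set p | _] = [set p : T * T | 0 < p.2] `&` [set p | p.2 < p.1]).
    by apply: measurableI; apply: measurable_lt_set => //.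
  apply/seteqP; split => -[s v] /=; rewrite !in_itv/= andbT; first by move=> [_ /andP].
  by move=> [h1 h2]; split; [lra|apply/andP].
- move=> s v /=; rewrite !in_itv/= !andbT; split.
    by move=> [_ /andP].
  by move=> [h1 h2]; split; [lra|apply/andP].
- by move=> p; rewrite lee_fin.
rewrite -ge0_integralZl//; last 2 first.
- apply: measurable_funTS.
  apply: (@measurable_fun_integral_dom _ _ T T R mu (fun v => `]v, +oo[%classic)
    (fun p => (F p.2 p.1)%:E)).
  + rewrite (_ : [set p | _] = [set p : T * T | p.1 < p.2]).
      exact: measurable_lt_set.
    by apply/seteqP; split => -[u v] /=; rewrite in_itv/= andbT.
  + exact: (measurableT_comp mF (@measurable_swap _ _ T T)).
  + by move=> p; rewrite lee_fin.
- by move=> s _; apply: integral_ge0 => v _; rewrite lee_fin.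
rewrite le_eqVlt; apply/orP; left; apply/eqP.
apply: eq_integral => v; rewrite inE/= in_itv/= andbT => v0.
rewrite /F; under eq_integral do rewrite EFinM.
rewrite ge0_integralZr//; last 3 first.
- apply/measurable_EFinP/measurable_funTS.
  by apply: measurable_funM => //; exact: measurable_powR.
- by move=> s _; rewrite lee_fin mulr_ge0 ?powR_ge0// ltW.
- by rewrite lee_fin expRV_derive_ge0.
rewrite integral_powR_tail// -!EFinM /expRV_derive; congr EFin.
have -> : - (b + 1) - 1 = - b + - 2%:R by ring.
rewrite powRD; last by rewrite (gt_eqF v0) implybT.
rewrite powR_invn ?ltW//.
by field; rewrite gt_eqF.
Qed.

Lemma heat_time_le (beta t : R) (G : R -> \bar R) : 0 < beta -> 0 < t ->
  measurable_fun setT G -> (forall v, 0 <= G v)%E ->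
  (\int[mu]_(v in `]t, +oo[) (((v - t) `^ beta)%:E * G v) +
   \int[mu]_(s in `]0%R, t[) \int[mu]_(v in `]s, +oo[)
     ((beta * (v - s) `^ (beta - 1))%:E * G v) <=
   \int[mu]_(v in `]0%R, +oo[) ((v `^ beta)%:E * G v))%E.
Proof.
move=> beta0 t0 mG G0.
have mF : measurable_fun setT
    (fun p : T * T => (beta * (p.2 - p.1) `^ (beta - 1))%:E * G p.2)%E.
  apply: emeasurable_funM; last exact: (measurableT_comp mG measurable_snd).
  apply/measurable_EFinP; apply: measurable_funM => //.
  by apply: (measurableT_comp (measurable_powR _)); exact: measurable_funB.
have F0 (s v : R) : (0 <= (beta * (v - s) `^ (beta - 1))%:E * G v)%E.
  by rewrite mule_ge0// lee_fin mulr_ge0 ?powR_ge0// ltW.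
rewrite (@fubini_tonelli_dom _ _ T T R mu mu `]0%R, t[%classic
  (fun s => `]s, +oo[%classic) `]0%R, +oo[%classic
  (fun v => `]0%R, (Num.min t v)[%classic) _ _ _ mF); last 3 first.
- rewrite (_ : [set p | _] = [set p : T * T | 0 < p.1] `&`
      [set p | p.1 < t] `&` [set p | p.1 < p.2]).
    by apply: measurableI; [apply: measurableI|]; apply: measurable_lt_set.
  by apply/seteqP; split => -[s v] /=; rewrite !in_itv/= andbT => -[/andP].
- move=> s v /=; rewrite !in_itv/= !andbT lt_min; split.
    by move=> [/andP[h1 ->] h2]; rewrite h1 h2; split => //; lra.
  by move=> [_ /and3P[-> -> ->]].
- by move=> p; exact: F0.
have mmin : measurable_fun setT (fun v : R => (v - Num.min t v) `^ beta).
  apply: (measurableT_comp (measurable_powR _)); apply: measurable_funB => //.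
  exact: measurable_minr.
have -> : (\int[mu]_(v in `]t, +oo[) (((v - t) `^ beta)%:E * G v) =
    \int[mu]_(v in `]0%R, +oo[) (((v - Num.min t v) `^ beta)%:E * G v))%E.
  rewrite integral_mkcond [RHS]integral_mkcond; apply: eq_integral => v _.
  rewrite !patchE !mem_setE !in_itv/= !andbT.
  have [tv|vt] := ltP t v; first by rewrite ifT//; lra.
  by case: ifPn => // _; rewrite subrr powR0 ?gt_eqF// mul0e.
have mI : measurable_fun setT (fun v => \int[mu]_(s in `]0%R, (Num.min t v)[)
    ((beta * (v - s) `^ (beta - 1))%:E * G v))%E.
  apply: (@measurable_fun_integral_dom _ _ T T R mu
    (fun v => `]0%R, (Num.min t v)[%classic)
    (fun p => (beta * (p.1 - p.2) `^ (beta - 1))%:E * G p.1)%E).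
  - rewrite (_ : [set p | _] = [set p : T * T | 0 < p.2] `&`
        [set p | p.2 < t] `&` [set p | p.2 < p.1]).
      by apply: measurableI; [apply: measurableI|]; apply: measurable_lt_set.
    apply/seteqP; split => -[v s] /=; rewrite in_itv/= lt_min; first by move/and3P => [].
    by move=> [[-> ->] ->].
  - exact: (measurableT_comp mF (@measurable_swap _ _ T T)).
  - by move=> p; exact: F0.
rewrite -ge0_integralD//; last 4 first.
- by move=> v _; rewrite mule_ge0// lee_fin powR_ge0.
- by apply: measurable_funTS; apply: emeasurable_funM => //; exact/measurable_EFinP.
- by move=> v _; apply: integral_ge0 => s _; exact: F0.
- exact: measurable_funTS.
apply: ge0_le_integral => //.
- move=> v _; rewrite adde_ge0//; last by apply: integral_ge0 => s _; exact: F0.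
  by rewrite mule_ge0// lee_fin powR_ge0.
- apply: measurable_funTS; apply: emeasurable_funD => //.
  by apply: emeasurable_funM => //; exact/measurable_EFinP.
- apply: measurable_funTS; apply: emeasurable_funM => //.
  by apply/measurable_EFinP; exact: measurable_powR.
move=> v; rewrite /= in_itv/= andbT => v0.
rewrite ge0_integralZr//; last 2 first.
- apply/measurable_EFinP/measurable_funTS; apply: measurable_funM => //.
  exact: measurable_powR_shift.
- by move=> s _; rewrite lee_fin mulr_ge0 ?powR_ge0// ltW.
rewrite -ge0_muleDl; last 2 first.
- by rewrite lee_fin powR_ge0.
- by apply: integral_ge0 => s _; rewrite lee_fin mulr_ge0 ?powR_ge0// ltW.
rewrite lee_wpmul2r//.
have := @integral_powR_shift_le beta v (Num.min t v) beta0.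
rewrite lt_min t0 v0 ge_min lexx orbT => /(_ isT isT).
by rewrite EFinB leeBrDl// addeC.
Qed.

End time_integrals.

(** * Gaussian kernels on R^d *)

Section gauss_kernel.
Context {R : realType}.
Local Notation mu := (@lebesgue_measure R).
Local Notation T := (measurableTypeR R).

Definition gauss1 (t u : R) : R :=
  (4 * pi * t) `^ (- 2^-1) * expR (- (u ^+ 2 / (4 * t))).

Lemma gauss1_ge0 t u : 0 <= gauss1 t u.
Proof. by rewrite mulr_ge0 ?powR_ge0 ?expR_ge0. Qed.

Lemma measurable_gauss1 d (X : measurableType d) (f g : X -> R) :
  measurable_fun setT f -> measurable_fun setT g ->
  measurable_fun setT (fun w => gauss1 (f w) (g w)).
Proof.
move=> mf mg; apply: measurable_funM.
  by apply: (measurableT_comp (measurable_powR _)); apply: measurable_funM.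
apply: measurableT_comp => //; apply: measurableT_comp => //.
apply: measurable_funM; first exact: measurable_funX.
by apply: (measurableT_comp (@measurable_invr R)); apply: measurable_funM.
Qed.

Lemma gauss1_normal_pdf (t m u : R) : 0 < t ->
  gauss1 t (u - m) = normal_pdf m (Num.sqrt (2 * t)) u.
Proof.
move=> t0; have t2 : 0 < 2 * t by rewrite mulr_gt0.
rewrite normal_pdfE ?gt_eqF ?sqrtr_gt0// /normal_peak /normal_fun.
rewrite sqr_sqrtr ?ltW//; congr (_ * expR _).
  rewrite powRN powR12_sqrt; last by rewrite !mulr_ge0 ?pi_ge0// ltW.
  by congr (Num.sqrt _)^-1; rewrite -mulr_natr; ring.
by rewrite mulNr; congr (- (_ / _)); rewrite -mulr_natr; ring.
Qed.

Lemma integral_gauss1 (t x : R) : 0 < t ->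
  (\int[mu]_y (gauss1 t (y - x))%:E = 1)%E.
Proof.
move=> t0; under eq_integral do rewrite gauss1_normal_pdf//.
exact: integral_normal_pdf.
Qed.

Lemma gauss1_mul (t s x y : R) : 0 < t -> 0 < s ->
  gauss1 t (y - x) * gauss1 s y =
  gauss1 (t + s) x * gauss1 (t * s / (t + s)) (y - x * s / (t + s)).
Proof.
move=> t0 s0; have ts : 0 < t + s by rewrite addr_gt0.
have p4 : 0 < 4 * @pi R by rewrite mulr_gt0 ?pi_gt0.
have q0 : 0 < t * s / (t + s) by rewrite divr_gt0 ?mulr_gt0.
rewrite /gauss1 mulrACA [RHS]mulrACA -!powRM ?(ltW (mulr_gt0 p4 _))//.
rewrite -!expRD; congr (_ `^ _ * expR _); field; rewrite ?gt_eqF ?invr_gt0 ?pi_gt0//.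
Qed.

Lemma gauss1_conv (t s x : R) : 0 < t -> 0 < s ->
  (\int[mu]_y (gauss1 t (y - x) * gauss1 s y)%:E = (gauss1 (t + s) x)%:E)%E.
Proof.
move=> t0 s0; under eq_integral do rewrite gauss1_mul// EFinM.
rewrite ge0_integralZl//.
- by rewrite integral_gauss1 ?mule1// divr_gt0 ?mulr_gt0 ?addr_gt0.
- by apply/measurable_EFinP; apply: measurable_gauss1 => //; exact: measurable_funB.
- by move=> y _; rewrite lee_fin gauss1_ge0.
- by rewrite lee_fin gauss1_ge0.
Qed.

Lemma ge0_integral_rV_cons n (f : 'rV[T]_n.+1 -> \bar R) :
  measurable_fun setT f -> (forall x, 0 <= f x)%E ->
  (\int[lebesgue_rV n.+1]_x f x =
   \int[mu]_u \int[lebesgue_rV n]_x f (rV_cons (u, x)))%E.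
Proof.
move=> mf f0.
have mc := @measurable_rV_cons R n.
rewrite -(@fubini_tonelli1 _ _ _ _ _ mu (lebesgue_rV n) (f \o @rV_cons R n)) /=.
- exact: (@ge0_integral_pushforward _ _ _ _ R _ mc (mu \x lebesgue_rV n)%E setT f).
- exact: (measurableT_comp mf mc).
- by move=> p; exact: f0.
Qed.

Lemma integral_rV_prod n (f : 'I_n -> R -> R) :
  (forall i, measurable_fun setT (f i)) -> (forall i u, 0 <= f i u) ->
  (\int[lebesgue_rV n]_x (\prod_(i < n) f i (x ord0 i))%:E =
   \prod_(i < n) \int[mu]_u (f i u)%:E)%E.
Proof.
elim: n f => [|n IH] f mf f0.
  rewrite big_ord0 /=; under eq_integral do rewrite big_ord0.
  by rewrite integral_cst//= diracT mul1e.
have mprod m (g : 'I_m -> R -> R) : (forall i, measurable_fun setT (g i)) ->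
    measurable_fun setT (fun x : 'rV[T]_m => \prod_(i < m) g i (x ord0 i)).
  move=> mg; apply: measurable_prod => i _.
  exact: (measurableT_comp (mg i) (measurable_rV_coord i)).
rewrite ge0_integral_rV_cons; last 2 first.
- by apply/measurable_EFinP; exact: mprod.
- by move=> x; rewrite lee_fin prodr_ge0.
rewrite big_ord_recl -IH//.
under eq_integral => u _.
  under eq_integral => x _.
    rewrite big_ord_recl rV_cons0 EFinM /=.
    under eq_bigr do rewrite rV_consS /=.
    over.
  rewrite ge0_integralZl//; last 3 first.
  - by apply/measurable_EFinP; apply: (mprod n (fun i => f (lift ord0 i))).
  - by move=> x _; rewrite lee_fin prodr_ge0.
  - by rewrite lee_fin.
  over.
rewrite ge0_integralZr//.
- by apply/measurable_EFinP; exact: (mf ord0).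
- by move=> u _; rewrite lee_fin.
- by apply: integral_ge0 => x _; rewrite lee_fin prodr_ge0.
Qed.

End gauss_kernel.

Section gauss_rV.
Context {R : realType} {d : nat}.
Local Notation mu := (@lebesgue_measure R).
Local Notation T := (measurableTypeR R).
Local Notation V := ('rV[T]_d).

Definition sqnorm (x : 'rV[R]_d) : R := \sum_(i < d) x ord0 i ^+ 2.

Lemma sqnorm_ge0 x : 0 <= sqnorm x.
Proof. by apply: sumr_ge0 => i _; exact: sqr_ge0. Qed.

Lemma sqr_enorm x : enorm x ^+ 2 = sqnorm x.
Proof. by rewrite sqr_sqrtr// sqnorm_ge0. Qed.

Lemma sqnorm_eq0 x : (sqnorm x == 0) = (x == 0).
Proof.
apply/idP/eqP => [|->]; last first.
  by apply/eqP; rewrite /sqnorm big1// => i _; rewrite mxE expr0n.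
rewrite psumr_eq0; last by move=> i _; exact: sqr_ge0.
move/allP => H; apply/rowP => i; rewrite mxE; apply/eqP.
by rewrite -sqrf_eq0; apply: H; rewrite mem_index_enum.
Qed.

Lemma sqnorm_gt0 x : (0 < sqnorm x) = (x != 0).
Proof. by rewrite lt_def sqnorm_eq0 sqnorm_ge0 andbT. Qed.

Lemma enormVpowE r x : x != 0 ->
  enormVpow r x = (sqnorm x `^ (- (r / 2)))%:E.
Proof.
move=> /negbTE x0; rewrite /enormVpow x0/=; congr EFin.
rewrite /enorm -powR12_sqrt ?sqnorm_ge0// -powRrM; congr powR; lra.
Qed.

Lemma enormVpow_ge0 r (x : 'rV[R]_d) : (0 <= enormVpow r x)%E.
Proof. by rewrite /enormVpow; case: ifP => // _; rewrite lee_fin powR_ge0. Qed.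

Lemma measurable_sqnorm : measurable_fun setT (sqnorm : V -> R).
Proof.
apply: measurable_sum => i; apply: measurable_funX.
exact: measurable_rV_coord.
Qed.

Lemma measurable_enormVpow r : measurable_fun setT (enormVpow r : V -> \bar R).
Proof.
have -> : (enormVpow r : V -> _) = fun x : V => (if (sqnorm x == 0%R) && (0 < r)%R
    then +oo else (sqnorm x `^ (- (r / 2)))%:E)%E.
  apply/funext => x; rewrite sqnorm_eq0.
  have [->|x0] := eqVneq x 0; last by rewrite enormVpowE.
  rewrite /enormVpow eqxx/=; case: ifP => // _; congr EFin.
  rewrite /enorm -powR12_sqrt ?sqnorm_ge0// -powRrM; congr powR; lra.
apply: measurable_fun_ifT => //.
  case: (ltP 0 r) => r0.
    under eq_fun do rewrite andbT.
    by apply: measurable_fun_eqr => //; exact: measurable_sqnorm.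
  by under eq_fun do rewrite andbF; exact: measurable_cst.
apply/measurable_EFinP; apply: (measurableT_comp (measurable_powR _)).
exact: measurable_sqnorm.
Qed.

Lemma rV_set10E :
  [set (0 : V)] = [set x | forall i, [set (0 : R)] (x ord0 i)].
Proof.
apply/seteqP; split => x /=; first by move=> -> i; rewrite mxE.
by move=> H; apply/rowP => i; rewrite H mxE.
Qed.

Lemma measurable_rV_set10 : measurable [set (0 : V)].
Proof.
rewrite rV_set10E; apply: (@measurable_box R d (fun=> [set (0 : R)])) => i.
exact: measurable_set1.
Qed.

Lemma lebesgue_rV_set10 : (0 < d)%N -> lebesgue_rV d [set (0 : V)] = 0%E.
Proof.
move=> d0; rewrite rV_set10E (@lebesgue_rV_box R d (fun=> [set (0 : R)])).
  rewrite (bigD1 (Ordinal d0))//= lebesgue_measure_set1 mul0e//.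
by move=> i; exact: measurable_set1.
Qed.

Lemma gauss_ge0 t (x : 'rV[R]_d) : 0 <= gauss t x.
Proof. by rewrite mulr_ge0 ?powR_ge0 ?expR_ge0. Qed.

Lemma gauss_prod t (x : 'rV[R]_d) : gauss t x = \prod_(i < d) gauss1 t (x ord0 i).
Proof.
rewrite /gauss big_split/= -expR_sum sqr_enorm; congr (_ * expR _).
  rewrite prodr_const card_ord -powR_mulrn ?powR_ge0// -powRrM.
  by congr powR; rewrite mulNr mulrC.
by rewrite sumrN /sqnorm mulr_suml.
Qed.

Lemma measurable_gauss d' (X : measurableType d') (f : X -> R) (g : X -> V) :
  measurable_fun setT f -> measurable_fun setT g ->
  measurable_fun setT (fun w => gauss (f w) (g w)).
Proof.
move=> mf mg; under eq_fun do rewrite gauss_prod.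
apply: measurable_prod => i _; apply: measurable_gauss1 => //.
by move/measurable_fun_rVP: mg; exact.
Qed.

Lemma measurable_rVB d' (X : measurableType d') (f g : X -> V) :
  measurable_fun setT f -> measurable_fun setT g ->
  measurable_fun setT (fun w => (f w - g w : V)).
Proof.
move=> /measurable_fun_rVP mf /measurable_fun_rVP mg; apply/measurable_fun_rVP => i.
by under eq_fun do rewrite !mxE; exact: (measurable_funB (mf i) (mg i)).
Qed.

Lemma integral_gauss t (x : V) : 0 < t ->
  (\int[lebesgue_rV d]_y (gauss t (y - x))%:E = 1)%E.
Proof.
move=> t0; under eq_integral do rewrite gauss_prod.
under eq_integral do under eq_bigr do rewrite !mxE.
rewrite (integral_rV_prod (f := fun i u => gauss1 t (u - x ord0 i))).
- by rewrite big1// => i _; exact: integral_gauss1.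
- by move=> i; apply: measurable_gauss1 => //; exact: measurable_funB.
- by move=> i u; exact: gauss1_ge0.
Qed.

Lemma gauss_conv t s (x : V) : 0 < t -> 0 < s ->
  (\int[lebesgue_rV d]_y (gauss t (y - x) * gauss s y)%:E =
   (gauss (t + s) x)%:E)%E.
Proof.
move=> t0 s0; under eq_integral do rewrite !gauss_prod -big_split/=.
under eq_integral do under eq_bigr do rewrite !mxE.
rewrite (integral_rV_prod (f := fun i u => gauss1 t (u - x ord0 i) * gauss1 s u)).
- by rewrite gauss_prod -prodEFin; apply: eq_bigr => i _; exact: gauss1_conv.
- move=> i; apply: measurable_funM; apply: measurable_gauss1 => //.
  exact: measurable_funB.
- by move=> i u; rewrite mulr_ge0 ?gauss1_ge0.
Qed.

End gauss_rV.

(** * Perturbation series *)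

Lemma ge0_nneseriesZl (R : realType) (k : \bar R) (a : (\bar R)^nat) :
  (0 <= k)%E -> (forall n, 0 <= a n)%E ->
  (\sum_(0 <= n <oo) (k * a n) = k * \sum_(0 <= n <oo) a n)%E.
Proof.
case: k => [k| |] // k0 a0; first by rewrite nneseriesZl.
have [a00|/existsNP[n /eqP an]] := pselect (forall n, a n = 0%E).
  rewrite eseries0 => [|n _ _]; last by rewrite a00 mule0.
  by rewrite eseries0 ?mule0.
have {}an : (0 < a n)%E by rewrite lt_def an a0.
have ka0 m : (0 <= +oo * a m)%E by rewrite mule_ge0.
rewrite (nneseriesD1 (f := (fun n => +oo * a n)%E) (n := n))//=.
rewrite [(+oo * a n)%E]gt0_mulye// addye; last first.
  by rewrite gt_eqF// (lt_le_trans (ltNyr 0))// nneseries_ge0.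
rewrite gt0_mulye// (nneseriesD1 (f := a) (n := n))//.
by rewrite (lt_le_trans an)// leeDl// nneseries_ge0.
Qed.

Section supermedian.
Local Open Scope ereal_scope.
Context {R : realType} {d : nat}.
Local Notation mu := (@lebesgue_measure R).
Local Notation T := (measurableTypeR R).
Local Notation V := ('rV[T]_d).
Variables (g : R -> 'rV[R]_d -> 'rV[R]_d -> \bar R) (q w : 'rV[R]_d -> \bar R).
Hypothesis mg : measurable_fun setT (fun p : T * V * V => g p.1.1 p.1.2 p.2).
Hypothesis g0 : forall t x y, 0 <= g t x y.
Hypothesis mq : measurable_fun setT (q : V -> \bar R).
Hypothesis q0 : forall x, 0 <= q x.
Hypothesis mw : measurable_fun setT (w : V -> \bar R).
Hypothesis w0 : forall x, 0 <= w x.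

Local Notation term := (schrodinger_term g q).

Lemma schrodinger_term_ge0 n t x y : 0 <= term n t x y.
Proof.
elim: n t x y => [|n IH] t x y //=.
apply: integral_ge0 => s _; apply: integral_ge0 => z _.
by rewrite mule_ge0// mule_ge0.
Qed.

Lemma measurable_schrodinger_integrand n :
  measurable_fun setT (fun p : T * V * V => term n p.1.1 p.1.2 p.2) ->
  measurable_fun setT (fun p : T * V * V * T * V =>
    g p.1.2 p.1.1.1.2 p.2 * q p.2 * term n (p.1.1.1.1 - p.1.2)%R p.2 p.1.1.2).
Proof.
move=> mn.
have m1 := @measurable_fst _ _ (T * V * V * T)%type V.
have m2 := @measurable_snd _ _ (T * V * V * T)%type V.
have m11 := measurableT_comp (@measurable_fst _ _ (T * V * V)%type T) m1.
have m12 := measurableT_comp (@measurable_snd _ _ (T * V * V)%type T) m1.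
have m111 := measurableT_comp (@measurable_fst _ _ (T * V)%type V) m11.
have m112 := measurableT_comp (@measurable_snd _ _ (T * V)%type V) m11.
have m1111 := measurableT_comp (@measurable_fst _ _ T V) m111.
have m1112 := measurableT_comp (@measurable_snd _ _ T V) m111.
apply: emeasurable_funM; first apply: emeasurable_funM.
- exact: (measurableT_comp mg (measurable_fun_pair (measurable_fun_pair m12 m1112) m2)).
- exact: (measurableT_comp mq m2).
- apply: (measurableT_comp mn (measurable_fun_pair (measurable_fun_pair _ m2) m112)).
  exact: measurable_funB.
Qed.

Lemma measurable_schrodinger_term n :
  measurable_fun setT (fun p : T * V * V => term n p.1.1 p.1.2 p.2).
Proof.
elim: n => [|n IH] //=.
have mF := measurable_schrodinger_integrand IH.
have mG := @measurable_fun_integral_dom _ _ _ _ R (lebesgue_rV d) (fun=> setT)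
  _ measurableT mF.
apply: (@measurable_fun_integral_dom _ _ (T * V * V)%type T R mu (fun p => `]0%R, p.1.1[%classic)
  (fun p => \int[lebesgue_rV d]_z (g p.2 p.1.1.2 z * q z * term n (p.1.1.1 - p.2)%R z p.1.2))).
- rewrite (_ : [set p | _] =
      [set p : T * V * V * T | (0 < p.2)%R] `&` [set p | (p.2 < p.1.1.1)%R]).
    apply: measurableI; apply: measurable_lt_set => //.
    exact: (measurableT_comp (@measurable_fst _ _ T V)
      (measurableT_comp (@measurable_fst _ _ (T * V)%type V) measurable_fst)).
  by apply/seteqP; split => p /=; rewrite in_itv/= => /andP.
- apply: mG => p; rewrite mule_ge0 ?schrodinger_term_ge0// mule_ge0//.
- move=> p; apply: integral_ge0 => z _.
  by rewrite mule_ge0 ?schrodinger_term_ge0// mule_ge0.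
Qed.

Definition term_int n t x := \int[lebesgue_rV d]_y (term n t x y * w y).

Lemma term_int_ge0 n t x : 0 <= term_int n t x.
Proof.
by apply: integral_ge0 => y _; rewrite mule_ge0 ?schrodinger_term_ge0.
Qed.

Lemma measurable_term_int n :
  measurable_fun setT (fun p : T * V => term_int n p.1 p.2).
Proof.
apply: (@measurable_fun_integral_dom _ _ (T * V)%type V R (lebesgue_rV d) (fun=> setT)
  (fun p => term n p.1.1 p.1.2 p.2 * w p.2)).
- exact: measurableT.
- apply: emeasurable_funM; first exact: measurable_schrodinger_term.
  exact: (measurableT_comp mw measurable_snd).
- by move=> p; rewrite mule_ge0 ?schrodinger_term_ge0.
Qed.

Lemma measurable_term_int_integrand n t x :
  measurable_fun setT (fun p : T * V =>
    g p.1 x p.2 * q p.2 * term_int n (t - p.1)%R p.2).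
Proof.
apply: emeasurable_funM; first apply: emeasurable_funM.
- apply: (measurableT_comp mg (measurable_fun_pair (measurable_fun_pair _ _) _)) => //.
- exact: (measurableT_comp mq measurable_snd).
- apply: (measurableT_comp (measurable_term_int n) (measurable_fun_pair _ _)) => //.
  exact: measurable_funB.
Qed.

Lemma term_intS n t x :
  term_int n.+1 t x = \int[mu]_(s in `]0%R, t[) \int[lebesgue_rV d]_z
    (g s x z * q z * term_int n (t - s)%R z).
Proof.
pose F (s : R) (z y : 'rV[R]_d) := g s x z * q z * term n (t - s)%R z y.
have F0 s z y : 0 <= F s z y by rewrite mule_ge0 ?schrodinger_term_ge0// mule_ge0.
have mF : measurable_fun setT (fun p : T * V * V => F p.1.1 p.1.2 p.2).
  pose phi (p : T * V * V) : T * V * V * T * V := (((t, x), p.2), p.1.1, p.1.2).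
  have mphi : measurable_fun setT phi.
    apply: measurable_fun_pair.
      by apply: measurable_fun_pair; [exact: measurable_fun_pair|exact: measurableT_comp].
    exact: measurableT_comp.
  exact: (measurableT_comp
    (measurable_schrodinger_integrand (measurable_schrodinger_term n)) mphi).
have mFz : measurable_fun setT (fun p : V * T => \int[lebesgue_rV d]_z F p.2 z p.1).
  apply: (@measurable_fun_integral_dom _ _ (V * T)%type V R (lebesgue_rV d) (fun=> setT)
    (fun p => F p.1.2 p.2 p.1.1) measurableT) => //.
  pose phi (p : V * T * V) : T * V * V := (p.1.2, p.2, p.1.1).
  have mphi : measurable_fun setT phi.
    apply: measurable_fun_pair; last exact: measurableT_comp.
    by apply: measurable_fun_pair => //; exact: measurableT_comp.
  exact: (measurableT_comp mF mphi).
have mFs y : measurable_fun setT (fun s : T => \int[lebesgue_rV d]_z F s z y).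
  exact: (measurableT_comp mFz (@pair1_measurable _ _ V T y)).
have mFyz s : measurable_fun setT (fun p : V * V => F s p.2 p.1).
  pose phi (p : V * V) : T * V * V := (s, p.2, p.1).
  have mphi : measurable_fun setT phi.
    by apply: measurable_fun_pair => //; exact: measurable_fun_pair.
  exact: (measurableT_comp mF mphi).
transitivity (\int[lebesgue_rV d]_y \int[mu]_(s in `]0%R, t[)
    ((\int[lebesgue_rV d]_z F s z y) * w y)).
  apply: eq_integral => y _; rewrite ge0_integralZr//.
  - exact: measurable_funTS.
  - by move=> s _; apply: integral_ge0.
rewrite (@fubini_tonelli_dom _ _ V T R (lebesgue_rV d) mu setT (fun=> `]0%R, t[%classic)
  `]0%R, t[%classic (fun=> setT) (fun p => (\int[lebesgue_rV d]_z F p.2 z p.1) * w p.1)).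
- apply: eq_integral => s _.
  transitivity (\int[lebesgue_rV d]_y \int[lebesgue_rV d]_z (F s z y * w y)).
    apply: eq_integral => y _; rewrite -ge0_integralZr//.
    exact: (measurableT_comp (mFyz s) (@pair1_measurable _ _ V V y)).
  rewrite (@fubini_tonelli _ _ V V R (lebesgue_rV d) (lebesgue_rV d)
    (fun p => F s p.2 p.1 * w p.1)).
  + apply: eq_integral => z _; rewrite /F /term_int.
    rewrite -ge0_integralZl//.
    * by apply: eq_integral => y _; rewrite muleA.
    * apply: emeasurable_funM => //.
      exact: (measurableT_comp (measurable_schrodinger_term n)
        (@pair1_measurable _ _ (T * V)%type V ((t - s)%R, z))).
    * by move=> y _; rewrite mule_ge0 ?schrodinger_term_ge0.
    * by rewrite mule_ge0.
  + apply: emeasurable_funM => //; exact: (measurableT_comp mw measurable_fst).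
  + by move=> p; rewrite mule_ge0.
- rewrite (_ : [set p | _] = setT `*` `]0%R, t[%classic); first exact: measurableX.
  by apply/seteqP; split => p.
- by move=> y s; split => -[].
- by apply: emeasurable_funM => //; exact: (measurableT_comp mw measurable_fst).
- by move=> p; rewrite mule_ge0//; apply: integral_ge0.
Qed.

Hypothesis gw : forall t x, (0 < t)%R ->
  \int[lebesgue_rV d]_y (g t x y * w y) +
  \int[mu]_(s in `]0%R, t[) \int[lebesgue_rV d]_z (g s x z * (q z * w z)) <= w x.

Lemma sum_term_int_le N t x : (0 < t)%R -> \sum_(0 <= n < N) term_int n t x <= w x.
Proof.
elim: N t x => [|N IH] t x t0; first by rewrite big_nil.
rewrite big_nat_recl//; apply: le_trans (gw x t0); rewrite leeD2l//.
have mI n : measurable_fun setT (fun s : T => \int[lebesgue_rV d]_z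
    (g s x z * q z * term_int n (t - s)%R z)).
  apply: (@measurable_fun_integral_dom _ _ T V R (lebesgue_rV d) (fun=> setT) _ measurableT
    (measurable_term_int_integrand n t x)).
  by move=> p; rewrite mule_ge0 ?term_int_ge0// mule_ge0.
have I0 n s z : 0 <= g s x z * q z * term_int n (t - s)%R z.
  by rewrite mule_ge0 ?term_int_ge0// mule_ge0.
under eq_bigr do rewrite term_intS.
rewrite -ge0_integral_sum//; last 2 first.
- by move=> n; exact: measurable_funTS.
- by move=> n s _; apply: integral_ge0.
apply: ge0_le_integral => //.
- by move=> s _; apply: sume_ge0 => n _; apply: integral_ge0.
- by apply: measurable_funTS; apply: emeasurable_sum.
- apply: measurable_funTS.
  apply: (@measurable_fun_integral_dom _ _ T V R (lebesgue_rV d) (fun=> setT)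
    (fun p => g p.1 x p.2 * (q p.2 * w p.2)) measurableT).
    apply: emeasurable_funM.
      by apply: (measurableT_comp mg (measurable_fun_pair (measurable_fun_pair _ _) _)).
    apply: emeasurable_funM; first exact: (measurableT_comp mq measurable_snd).
    exact: (measurableT_comp mw measurable_snd).
  by move=> p; rewrite !mule_ge0.
move=> s; rewrite /= in_itv/= => /andP[s0 st].
have mz n : measurable_fun setT (fun z : V => g s x z * q z * term_int n (t - s)%R z).
  exact: (measurableT_comp (measurable_term_int_integrand n t x)
    (@pair1_measurable _ _ T V s)).
rewrite -ge0_integral_sum//.
apply: ge0_le_integral => //.
- by move=> z _; apply: sume_ge0.
- exact: emeasurable_sum.
- apply: emeasurable_funM; last exact: emeasurable_funM.
  by apply: (measurableT_comp mg (measurable_fun_pair (measurable_fun_pair _ _) _)).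
move=> z _; rewrite -ge0_sume_distrr; last by move=> n _; exact: term_int_ge0.
by rewrite -muleA lee_wpmul2l// lee_wpmul2l// IH// subr_gt0.
Qed.

Lemma schrodinger_perturbation_le t x : (0 < t)%R ->
  \int[lebesgue_rV d]_y (schrodinger_perturbation g q t x y * w y) <= w x.
Proof.
move=> t0.
have mn n : measurable_fun setT (fun y : V => term n t x y * w y).
  apply: emeasurable_funM => //.
  exact: (measurableT_comp (measurable_schrodinger_term n)
    (@pair1_measurable _ _ (T * V)%type V (t, x))).
under eq_integral => y _.
  rewrite /schrodinger_perturbation muleC -ge0_nneseriesZl//; last first.
    by move=> n; exact: schrodinger_term_ge0.
  under eq_eseriesr do rewrite muleC.
  over.
rewrite integral_nneseries//; last first.
  by move=> n y _; rewrite mule_ge0 ?schrodinger_term_ge0.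
apply: lime_le.
  by apply: is_cvg_nneseries => n _ _; exact: term_int_ge0.
by apply: nearW => N; exact: sum_term_int_le.
Qed.

End supermedian.

(** * Powers of the norm as mixtures of heat kernels *)

Section heat.
Context {R : realType} {d : nat}.
Hypothesis d0 : (0 < d)%N.
Local Notation mu := (@lebesgue_measure R).
Local Notation T := (measurableTypeR R).
Local Notation V := ('rV[T]_d).

Definition heat_mixture (beta : R) (x : 'rV[R]_d) : \bar R :=
  \int[mu]_(s in `]0%R, +oo[) (s `^ beta * gauss s x)%:E.

Lemma heat_mixture_integrand_ge0 beta s (x : 'rV[R]_d) : 0 <= s `^ beta * gauss s x.
Proof. by rewrite mulr_ge0 ?powR_ge0 ?gauss_ge0. Qed.

Lemma measurable_heat_mixture_integrand (beta : R) :
  measurable_fun setT (fun p : V * T => p.2 `^ beta * gauss p.2 p.1).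
Proof.
apply: measurable_funM; last exact: measurable_gauss.
exact: (measurableT_comp (measurable_powR beta) measurable_snd).
Qed.

Lemma measurable_heat_mixture (beta : R) :
  measurable_fun setT (heat_mixture beta : V -> \bar R).
Proof.
apply: (@measurable_fun_integral_dom _ _ V T R mu (fun=> `]0%R, +oo[%classic)
  (fun p => (p.2 `^ beta * gauss p.2 p.1)%:E)).
- rewrite (_ : [set p | _] = setT `*` `]0%R, +oo[%classic); first exact: measurableX.
  by apply/seteqP; split => p // [].
- by apply/measurable_EFinP; exact: measurable_heat_mixture_integrand.
- by move=> p; rewrite lee_fin heat_mixture_integrand_ge0.
Qed.

Lemma heat_mixture_ge0 beta x : (0 <= heat_mixture beta x)%E.
Proof.
by apply: integral_ge0 => s _; rewrite lee_fin heat_mixture_integrand_ge0.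
Qed.

Lemma heat_mixtureE (b beta : R) (x : 'rV[R]_d) :
  x != 0 -> beta = d%:R / 2 - 1 - b ->
  (heat_mixture beta x =
   ((4 * pi) `^ (- (d%:R / 2)) * sqnorm x `^ (- b))%:E * gamma_integral b)%E.
Proof.
move=> x0 betaE; have rho0 : 0 < sqnorm x by rewrite sqnorm_gt0.
have p4 : 0 <= 4 * @pi R by rewrite mulr_ge0 ?pi_ge0.
rewrite EFinM -muleA -gamma_integral_scale// -ge0_integralZl//; last 3 first.
- apply/measurable_EFinP/measurable_funTS; apply: measurable_funM.
    exact: measurable_powR.
  apply: measurableT_comp => //; apply: measurableT_comp => //.
  apply: measurable_funM => //.
  by apply: (measurableT_comp (@measurable_invr R)); exact: measurable_funM.
- by move=> s _; rewrite lee_fin mulr_ge0 ?powR_ge0 ?expR_ge0.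
- by rewrite lee_fin powR_ge0.
apply: eq_integral => s; rewrite inE/= in_itv/= andbT => s0.
rewrite -EFinM /gauss sqr_enorm powRM ?(ltW s0)//; congr EFin.
rewrite -mulrA mulrCA; congr (_ * _); rewrite mulrA; congr (_ * _).
rewrite -powRD; last by rewrite (gt_eqF s0) implybT.
by congr powR; rewrite betaE; ring.
Qed.

Lemma heat_apply_mixture (beta t : R) (x : V) : 0 < t ->
  (\int[lebesgue_rV d]_y ((gauss t (y - x))%:E * heat_mixture beta y) =
   \int[mu]_(v in `]t, +oo[) ((v - t) `^ beta * gauss v x)%:E)%E.
Proof.
move=> t0.
pose F (p : V * T) := ((gauss t (p.1 - x))%:E * (p.2 `^ beta * gauss p.2 p.1)%:E)%E.
have mF : measurable_fun setT F.
  apply: emeasurable_funM; apply/measurable_EFinP; last first.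
    exact: measurable_heat_mixture_integrand.
  by apply: measurable_gauss => //; exact: measurable_rVB.
have F0 p : (0 <= F p)%E.
  by rewrite mule_ge0 ?lee_fin ?gauss_ge0 ?heat_mixture_integrand_ge0.
transitivity (\int[lebesgue_rV d]_y \int[mu]_(s in `]0%R, +oo[) F (y, s))%E.
  apply: eq_integral => y _; rewrite /F /= ge0_integralZl//.
  - apply/measurable_EFinP/measurable_funTS.
    exact: (measurableT_comp (measurable_heat_mixture_integrand beta)
      (@pair1_measurable _ _ V T y)).
  - by move=> s _; rewrite lee_fin heat_mixture_integrand_ge0.
  - by rewrite lee_fin gauss_ge0.
rewrite (@fubini_tonelli_dom _ _ V T R (lebesgue_rV d) mu setT
  (fun=> `]0%R, +oo[%classic) `]0%R, +oo[%classic (fun=> setT) F)//; last 2 first.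
- rewrite (_ : [set p | _] = setT `*` `]0%R, +oo[%classic); first exact: measurableX.
  by apply/seteqP; split => p.
- by move=> y s; split => -[].
rewrite ge0_integral_shift; last 2 first.
- apply/measurable_EFinP; apply: measurable_funM; last exact: measurable_gauss.
  by apply: (measurableT_comp (measurable_powR _)); exact: measurable_funB.
- by move=> s; rewrite lee_fin mulr_ge0 ?powR_ge0 ?gauss_ge0.
apply: eq_integral => s; rewrite inE/= in_itv/= andbT => s0.
rewrite addrK EFinM addrC -gauss_conv// -ge0_integralZl//.
- by apply: eq_integral => y _; rewrite /F -!EFinM; congr EFin; ring.
- apply/measurable_EFinP; apply: measurable_funM; apply: measurable_gauss => //.
  exact: measurable_rVB.
- by move=> y _; rewrite lee_fin mulr_ge0 ?gauss_ge0.
- by rewrite lee_fin powR_ge0.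
Qed.

Lemma integral_rV_neq0_le (f h : V -> \bar R) :
  measurable_fun setT f -> measurable_fun setT h ->
  (forall x, 0 <= f x)%E -> (forall x, 0 <= h x)%E ->
  (forall x : V, (x != 0)%R -> f x <= h x)%E ->
  (\int[lebesgue_rV d]_x f x <= \int[lebesgue_rV d]_x h x)%E.
Proof.
move=> mf mh f0 h0 fh; apply: ae_ge0_le_integral => //.
exists [set 0]; split.
- exact: measurable_rV_set10.
- exact: lebesgue_rV_set10.
- move=> x /= H; apply: contrapT => /eqP x0; apply: H => _; exact: fh.
Qed.

(* The constant [c] with [c |x|^{-r} = \int_0^oo s^beta g_s(x) ds]. *)
Definition mixture_const (r : R) : R :=
  (4 * pi) `^ (- (d%:R / 2)) * fine (gamma_integral (r / 2)).

Lemma mixture_const_gt0 r : 0 < r -> 0 < mixture_const r.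
Proof.
move=> r0; rewrite mulr_gt0// ?powR_gt0 ?mulr_gt0 ?pi_gt0//.
by rewrite fine_gt0// gamma_integral_gt0 gamma_integral_lty// divr_gt0.
Qed.

Lemma enormVpow_mixture (r : R) (x : 'rV[R]_d) : 0 < r -> x != 0 ->
  ((mixture_const r)%:E * enormVpow r x = heat_mixture ((d%:R - 2 - r) / 2) x)%E.
Proof.
move=> r0 x0; rewrite (@heat_mixtureE (r / 2))//; last lra.
rewrite enormVpowE// /mixture_const !EFinM fineK; first by rewrite muleAC.
by rewrite ge0_fin_numE ?gamma_integral_lty ?divr_gt0// ltW// gamma_integral_gt0.
Qed.

Lemma heat_enormVpow_le (r t : R) (x : V) : 0 < r -> 0 < t ->
  ((mixture_const r)%:E *
     \int[lebesgue_rV d]_y (gauss_kernel t x y * enormVpow r y) <=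
   \int[mu]_(v in `]t, +oo[) ((v - t) `^ ((d%:R - 2 - r) / 2) * gauss v x)%:E)%E.
Proof.
move=> r0 t0; have c0 := ltW (mixture_const_gt0 r0).
have mgx : measurable_fun setT (fun y : V => gauss_kernel t x y).
  by apply/measurable_EFinP; apply: measurable_gauss => //; exact: measurable_rVB.
have mgw : measurable_fun setT (fun y : V => gauss_kernel t x y * enormVpow r y)%E.
  by apply: emeasurable_funM => //; exact: measurable_enormVpow.
rewrite -heat_apply_mixture// -ge0_integralZl//; last first.
  by move=> y _; rewrite mule_ge0 ?lee_fin ?gauss_ge0 ?enormVpow_ge0.
apply: integral_rV_neq0_le => //.
- exact: emeasurable_funM.
- by apply: emeasurable_funM => //; exact: measurable_heat_mixture.
- by move=> y; rewrite !mule_ge0 ?lee_fin ?gauss_ge0 ?enormVpow_ge0.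
- by move=> y; rewrite mule_ge0 ?lee_fin ?gauss_ge0 ?heat_mixture_ge0.
- by move=> y y0; rewrite muleCA enormVpow_mixture.
Qed.

Lemma hardy_mixture_le (r : R) (x : 'rV[R]_d) : 0 < r -> r < d%:R - 2 -> x != 0 ->
  ((mixture_const r)%:E * (hardy_potential (d%:R - 2 - r) x * enormVpow r x) <=
   ((d%:R - 2 - r) / 2)%:E * heat_mixture ((d%:R - 2 - r) / 2 - 1) x)%E.
Proof.
move=> r0 rd x0; rewrite (@heat_mixtureE (r / 2 + 1))//; last lra.
have b0 : 0 < r / 2 by rewrite divr_gt0.
have kfin : gamma_integral (r / 2) \is a fin_num.
  by rewrite ge0_fin_numE ?gamma_integral_lty// ltW// gamma_integral_gt0.
apply: (@le_trans _ _ (((d%:R - 2 - r) / 2)%:E * (((4 * pi) `^ (- (d%:R / 2)) *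
    sqnorm x `^ (- (r / 2 + 1)))%:E * ((4 * (r / 2))%:E * gamma_integral (r / 2))))%E); last first.
  rewrite lee_wpmul2l ?lee_fin//; first lra.
  by rewrite lee_wpmul2l ?gamma_integral_succ// lee_fin mulr_ge0 ?powR_ge0.
rewrite /hardy_potential !enormVpowE// /mixture_const -(fineK kfin)/= -!EFinM lee_fin.
have -> : sqnorm x `^ (- (r / 2 + 1)) =
    sqnorm x `^ (- (2 / 2)) * sqnorm x `^ (- (r / 2)).
  rewrite -powRD; last by rewrite sqnorm_eq0 (negbTE x0) implybT.
  by congr powR; field.
by rewrite le_eqVlt; apply/orP; left; apply/eqP; field.
Qed.

Lemma heat_hardy_le (r t : R) (x : V) : 0 < r -> r < d%:R - 2 -> 0 < t ->
  (\int[lebesgue_rV d]_y (gauss_kernel t x y * enormVpow r y) +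
   \int[mu]_(s in `]0%R, t[) \int[lebesgue_rV d]_z
     (gauss_kernel s x z * (hardy_potential (d%:R - 2 - r) z * enormVpow r z))
   <= enormVpow r x)%E.
Proof.
move=> r0 rd t0; have [->|x0] := eqVneq x 0.
  by rewrite [leRHS]/enormVpow eqxx r0 leey.
have c0 := mixture_const_gt0 r0.
set beta := (d%:R - 2 - r) / 2.
have beta0 : 0 < beta by rewrite divr_gt0// subr_gt0.
have mgp : measurable_fun setT (fun p : T * V => gauss_kernel p.1 x p.2).
  by apply/measurable_EFinP; apply: measurable_gauss => //; exact: measurable_rVB.
have mqw : measurable_fun setT (fun z : V =>
    hardy_potential (d%:R - 2 - r) z * enormVpow r z)%E.
  apply: emeasurable_funM; last exact: measurable_enormVpow.
  by apply: emeasurable_funM => //; exact: measurable_enormVpow.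
have qw0 (z : 'rV[R]_d) : (0 <= hardy_potential (d%:R - 2 - r) z * enormVpow r z)%E.
  rewrite !mule_ge0 ?enormVpow_ge0// lee_fin mulr_ge0//; lra.
have mI : measurable_fun setT (fun s : T => \int[lebesgue_rV d]_z
    (gauss_kernel s x z * (hardy_potential (d%:R - 2 - r) z * enormVpow r z)))%E.
  apply: (@measurable_fun_integral_dom _ _ T V R (lebesgue_rV d) (fun=> setT)
    (fun p => gauss_kernel p.1 x p.2 *
      (hardy_potential (d%:R - 2 - r) p.2 * enormVpow r p.2))%E measurableT).
    by apply: emeasurable_funM => //; exact: (measurableT_comp mqw measurable_snd).
  by move=> p; rewrite mule_ge0// lee_fin gauss_ge0.
have I0 s : (0 <= \int[lebesgue_rV d]_z
    (gauss_kernel s x z * (hardy_potential (d%:R - 2 - r) z * enormVpow r z)))%E.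
  by apply: integral_ge0 => z _; rewrite mule_ge0// lee_fin gauss_ge0.
rewrite -(@lee_pmul2l _ (mixture_const r)%:E)// enormVpow_mixture//.
rewrite ge0_muleDr; last 2 first.
- by apply: integral_ge0 => y _; rewrite mule_ge0 ?lee_fin ?gauss_ge0 ?enormVpow_ge0.
- by apply: integral_ge0.
have mG : measurable_fun setT (fun v : R => (gauss v x)%:E).
  by apply/measurable_EFinP; exact: measurable_gauss.
have := @heat_time_le R beta t (fun v => (gauss v x)%:E) beta0 t0 mG.
move=> /(_ (fun v => _)) H.
rewrite /heat_mixture; under [leRHS]eq_integral do rewrite EFinM.
apply: le_trans (H _); last by move=> v; rewrite lee_fin gauss_ge0.
apply: leeD.
  by under [leRHS]eq_integral do rewrite -EFinM; exact: heat_enormVpow_le.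
rewrite -ge0_integralZl//; last 2 first.
- exact: measurable_funTS.
- by rewrite lee_fin ltW.
apply: ge0_le_integral => //.
- by move=> s _; rewrite mule_ge0// lee_fin ltW.
- by apply: measurable_funTS; exact: emeasurable_funM.
- apply: measurable_funTS.
  apply: (@measurable_fun_integral_dom _ _ T T R mu (fun s => `]s, +oo[%classic)
    (fun p => (beta * (p.2 - p.1) `^ (beta - 1))%:E * (gauss p.2 x)%:E)%E).
  + rewrite (_ : [set p | _] = [set p : T * T | p.1 < p.2]); first exact: measurable_lt_set.
    by apply/seteqP; split => p /=; rewrite in_itv/= andbT.
  + apply: emeasurable_funM; last exact: (measurableT_comp mG measurable_snd).
    apply/measurable_EFinP; apply: measurable_funM => //.
    by apply: (measurableT_comp (measurable_powR _)); exact: measurable_funB.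
  + by move=> p; rewrite mule_ge0 ?lee_fin ?gauss_ge0// mulr_ge0 ?powR_ge0// ltW.
move=> s; rewrite /= in_itv/= => /andP[s0 st].
have mgx : measurable_fun setT (fun y : V => gauss_kernel s x y).
  exact: (measurableT_comp mgp (@pair1_measurable _ _ T V s)).
rewrite -ge0_integralZl//; last 3 first.
- exact: emeasurable_funM.
- by move=> z _; rewrite mule_ge0// lee_fin gauss_ge0.
- by rewrite lee_fin ltW.
apply: (@le_trans _ _ (beta%:E * \int[lebesgue_rV d]_y
    ((gauss s (y - x))%:E * heat_mixture (beta - 1) y))%E).
  rewrite -ge0_integralZl//; last 3 first.
  - by apply: emeasurable_funM => //; exact: measurable_heat_mixture.
  - by move=> y _; rewrite mule_ge0 ?lee_fin ?gauss_ge0 ?heat_mixture_ge0.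
  - by rewrite lee_fin ltW.
  apply: integral_rV_neq0_le => //.
  - by apply: emeasurable_funM => //; exact: emeasurable_funM.
  - by do 2 apply: emeasurable_funM => //; exact: measurable_heat_mixture.
  - move=> y; apply: mule_ge0; first by rewrite lee_fin ltW.
    by rewrite mule_ge0// lee_fin gauss_ge0.
  - move=> y; apply: mule_ge0; first by rewrite lee_fin ltW.
    by rewrite mule_ge0 ?heat_mixture_ge0// lee_fin gauss_ge0.
  - move=> y y0; rewrite muleCA [leRHS]muleCA lee_wpmul2l ?lee_fin ?gauss_ge0//.
    exact: hardy_mixture_le.
rewrite heat_apply_mixture// -ge0_integralZl//.
- by rewrite le_eqVlt; apply/orP; left; apply/eqP/eq_integral => v _; rewrite -!EFinM mulrA.
- apply/measurable_EFinP/measurable_funTS.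
  apply: measurable_funM; last exact: measurable_gauss.
  by apply: (measurableT_comp (measurable_powR _)); exact: measurable_funB.
- by move=> v _; rewrite lee_fin mulr_ge0 ?powR_ge0 ?gauss_ge0.
- by rewrite lee_fin ltW.
Qed.

Lemma heat_le (r t : R) (x : V) : 0 <= r -> r <= d%:R - 2 -> 0 < t ->
  (\int[lebesgue_rV d]_y (gauss_kernel t x y * enormVpow r y) <= enormVpow r x)%E.
Proof.
rewrite le_eqVlt => /predU1P[<-|r0] rd t0.
  rewrite /enormVpow ltxx andbF oppr0 powRr0.
  under eq_integral do rewrite andbF powRr0 mule1.
  by rewrite integral_gauss.
have [->|x0] := eqVneq x 0.
  by rewrite [leRHS]/enormVpow eqxx r0 leey.
have c0 := mixture_const_gt0 r0.
rewrite -(@lee_pmul2l _ (mixture_const r)%:E)// enormVpow_mixture//.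
apply: le_trans (heat_enormVpow_le x r0 t0) _.
set beta := (d%:R - 2 - r) / 2.
have beta0 : 0 <= beta by rewrite divr_ge0// subr_ge0.
have mf (t' : R) (D : set R) : measurable D ->
    measurable_fun D (fun v : R => ((v - t') `^ beta * gauss v x)%:E).
  move=> mD; apply/measurable_EFinP/measurable_funTS.
  apply: measurable_funM; last exact: measurable_gauss.
  by apply: (measurableT_comp (measurable_powR _)); exact: measurable_funB.
have f0 (t' v : R) : (0 <= ((v - t') `^ beta * gauss v x)%:E)%E.
  by rewrite lee_fin mulr_ge0 ?powR_ge0 ?gauss_ge0.
apply: (@le_trans _ _ (\int[mu]_(v in `]t, +oo[) ((v - 0) `^ beta * gauss v x)%:E)%E).
  apply: ge0_le_integral => //; [exact: mf|exact: mf|].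
  move=> v; rewrite /= in_itv/= andbT => tv.
  by rewrite lee_fin ler_wpM2r ?gauss_ge0// ler_powRl//; lra.
rewrite /heat_mixture; under [leRHS]eq_integral do rewrite -[X in X `^ _]subr0.
apply: ge0_subset_integral => //; first exact: mf.
by apply: subset_itvr; rewrite bnd_simp ltW.
Qed.

End heat.

Theorem corollary8 (R : realType) (d : nat) (hd : (3 <= d)%N) :
  (forall (r : R) (x : 'rV[R]_d) (t : R),
     0 <= r -> r <= d%:R - 2 -> 0 < t ->
     (\int[lebesgue_rV d]_y (gauss_kernel t x y * enormVpow r y)
        <= enormVpow r x)%E) /\
  (forall (r : R) (x : 'rV[R]_d) (t : R),
     0 < r -> r < d%:R - 2 -> 0 < t ->
     let gamma := d%:R - 2 - r in
     (\int[lebesgue_rV d]_y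
         (schrodinger_perturbation (@gauss_kernel R d) (hardy_potential gamma)
            t x y * enormVpow r y)
        <= enormVpow r x)%E).
Proof.
have d0 : (0 < d)%N by exact: leq_trans hd.
split => r x t r0 rd t0; first exact: heat_le.
cbv zeta; apply: schrodinger_perturbation_le => //.
- apply/measurable_EFinP; apply: measurable_gauss.
    exact: (measurableT_comp measurable_fst measurable_fst).
  by apply: measurable_rVB => //; exact: (measurableT_comp measurable_snd measurable_fst).
- by move=> s y z; rewrite lee_fin gauss_ge0.
- by apply: emeasurable_funM => //; exact: measurable_enormVpow.
- move=> y; rewrite mule_ge0 ?enormVpow_ge0// lee_fin.
  by rewrite mulr_ge0//; lra.
- exact: measurable_enormVpow.
- by move=> y; exact: enormVpow_ge0.
- by move=> s y s0; exact: heat_hardy_le.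
Qed.
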